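(* Let $S$ be a finitely generated rational semigroup such that $\deg(f)\ge 2$ for every $f\in S$. Let $\mathcal G=\{f_1,\dots,f_N\}$ be a set of generators of $S$ and let $\mu_{\mathcal G}$ be Boyd's measure associated with $(S,\mathcal G)$. Let $B$ be a Borel subset of the Julia set $\mathbf{J}(S)$ such that $\mu_{\mathcal G}(B)>0$. Then for $\mu_{\mathcal G}$-almost every $x\in B$, there exist an increasing sequence $\{n_i\}$ of positive integers and words $g_1,g_2,g_3,\dots$ composed of $f_1,\dots,f_N$ such that $$l(g_i)=n_i,\qquad g_{i+1}=h_i\circ g_i\ \text{ for some word } h_i \text{ with } l(h_i)=n_{i+1}-n_i,$$ and such that $g_i(x)\in B$ for each $i\in\mathbb Z_+$.
   Context: $\widehat{\mathbb C}$ is the Riemann sphere; $\mathbb Z_+$ is the set of positive integers. A rational semigroup is a semigroup consisting of non-constant rational maps on $\widehat{\mathbb C}$ with composition as the semigroup operation. The Fatou set of $S$ is the largest open subset of $\widehat{\mathbb C}$ on which $S$ is a normal family; its complement is the Julia set $\mathbf{J}(S)$. Given a generating set $\mathcal G=\{f_1,\dots,f_N\}$, a word of length $n$ is an expression $g=f_{i_n}\circ\dots\circ f_{i_1}$ with $i_1,\dots,i_n\in\{1,\dots,N\}$; one writes $l(g)=n$. Boyd's measure: let $d_{\mathcal G}:=\deg(f_1)+\dots+\deg(f_N)$. By a theorem of Boyd, when every element of $S$ has degree at least $2$ there exist a set $E(S)\subset\widehat{\mathbb C}$ with at most two points, independent of $\mathcal G$, and a Borel probability measure $\mu_{\mathcal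 G}$ such that for each $a\in\widehat{\mathbb C}\setminus E(S)$, $$\frac{1}{d_{\mathcal G}^{\,n}}\sum_{g(z)=a,\ l(g)=n}\delta_z\longrightarrow\mu_{\mathcal G}\quad\text{as } n\to\infty$$ in the weak* topology, where the sum runs over all words $g$ of length $n$ and all solutions $z$ of $g(z)=a$ counted with multiplicity. This determines $\mu_{\mathcal G}$. *)

(* Defs.v *)
From HB Require Import structures.
From mathcomp Require Import all_boot all_order all_algebra.
From mathcomp Require Import complex.
From mathcomp Require Import all_classical all_reals all_analysis.
Set Implicit Arguments.
Unset Strict Implicit.
Unset Printing Implicit Defensive.
Import Order.TTheory GRing.Theory Num.Theory.
Import numFieldNormedType.Exports.

Local Open Scope classical_set_scope.
Local Open Scope ring_scope.

(* The Riemann sphere; [None] is the point at infinity.  The regular module   *)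
(* [R[i]^o] is the alias of [R[i]] that carries the topology of the modulus.  *)
Notation sphere R := (one_point_compactification R[i]^o).

Notation borel_sphere R := (g_sigma_algebraType (@open (sphere R))).

(* The Euclidean distance in R^3 transported by stereographic projection. It  *)
(* is a metric for the topology of [sphere R].                                *)
Definition chordal (R : realType) (x y : sphere R) : R :=
  let nm := @ComplexField.Normc.normc R in
  match x, y with
  | Some z, Some w =>
      2 * nm (z - w) / (Num.sqrt (1 + nm z ^+ 2) * Num.sqrt (1 + nm w ^+ 2))
  | Some z, None | None, Some z => 2 / Num.sqrt (1 + nm z ^+ 2)
  | None, None => 0
  end.

(* Rational maps.  A pair [pq] of coprime polynomials stands for the quotient *)
(* [pq.1 / pq.2]; the pair (1, 0) is the constant infinity.                   *)

Definition pair_degree (R : realType) (pq : {poly R[i]} * {poly R[i]}) : nat :=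
  (maxn (size pq.1) (size pq.2)).-1.

Definition pair_map (R : realType) (pq : {poly R[i]} * {poly R[i]})
    (x : sphere R) : sphere R :=
  let quo (a b : R[i]) : sphere R := if b == 0 then None else Some (a / b) in
  match x with
  | Some z => quo pq.1.[z] pq.2.[z]
  | None => quo pq.1`_(pair_degree pq) pq.2`_(pair_degree pq)
  end.

Definition represents (R : realType) (g : sphere R -> sphere R)
    (pq : {poly R[i]} * {poly R[i]}) : Prop :=
  coprimep pq.1 pq.2 /\ g = pair_map pq.

Definition rational_map (R : realType) (g : sphere R -> sphere R) : Prop :=
  exists pq, represents g pq.

Definition constant_map (R : realType) (g : sphere R -> sphere R) : Prop :=
  exists c, forall x, g x = c.

(* A representative of a rational map [g]; it is unique up to a common        *)
(* nonzero scalar factor, on which [degree] and [multiplicity] do not depend. *)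
Definition reduced_pair (R : realType) (g : sphere R -> sphere R) :
    {poly R[i]} * {poly R[i]} :=
  xget (0, 1) [set pq | represents g pq].

Definition degree (R : realType) (g : sphere R -> sphere R) : nat :=
  pair_degree (reduced_pair g).

(* The polynomial whose zeros in the plane are the finite solutions of        *)
(* [g z = a].                                                                 *)
Definition fiber_poly (R : realType) (g : sphere R -> sphere R)
    (a : sphere R) : {poly R[i]} :=
  let pq := reduced_pair g in
  if a is Some c then pq.1 - (c : R[i]) *: pq.2 else pq.2.

(* The multiplicity of [z] as a solution of [g z = a], for non-constant [g].  *)
(* At infinity, it is the drop of the degree of the fiber polynomial.         *)
Definition multiplicity (R : realType) (g : sphere R -> sphere R)
    (a z : sphere R) : nat :=
  if z is Some c then mup (c : R[i]) (fiber_poly g a)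
  else (degree g - (size (fiber_poly g a)).-1)%N.

Definition comp_closed (R : realType) (S : set (sphere R -> sphere R)) : Prop :=
  forall g h, S g -> S h -> S (g \o h).

Definition rational_semigroup (R : realType)
    (S : set (sphere R -> sphere R)) : Prop :=
  [/\ S !=set0,
      forall g, S g -> rational_map g /\ ~ constant_map g
    & comp_closed S].

Definition generated_by (R : realType) (S : set (sphere R -> sphere R))
    (N : nat) (f : 'I_N -> sphere R -> sphere R) : Prop :=
  S = smallest (@comp_closed R) (range f).

(* Every sequence in [S] has a subsequence that converges, uniformly on the   *)
(* compact subsets of [U], in the spherical metric.                           *)
Definition normal_on (R : realType) (S : set (sphere R -> sphere R))
    (U : set (sphere R)) : Prop :=
  forall u : nat -> sphere R -> sphere R, (forall k, S (u k)) ->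
  exists sub : nat -> nat, {homo sub : i j / (i < j)%N} /\
  exists v : sphere R -> sphere R,
  forall K : set (sphere R), compact K -> K `<=` U ->
  forall e : R, 0 < e ->
  \forall k \near \oo, forall z, K z -> chordal (u (sub k) z) (v z) < e.

(* Normality is local, so this union is itself normal: it is the largest open *)
(* set on which [S] is normal.                                                *)
Definition Fatou (R : realType) (S : set (sphere R -> sphere R)) :
    set (sphere R) :=
  \bigcup_(U in [set U | open U /\ normal_on S U]) U.

Definition Julia (R : realType) (S : set (sphere R -> sphere R)) :
    set (sphere R) :=
  ~` Fatou S.

(* A word [:: i_1; ...; i_n] lists its letters in the order in which the maps *)
(* are applied.                                                               *)
Definition word (N : nat) : Type := seq 'I_N.

Definition word_comp (N : nat) (h g : word N) : word N := g ++ h.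

(* [:: i_1; ...; i_n] is sent to f i_n \o ... \o f i_1.                       *)
Definition word_map (R : realType) (N : nat) (f : 'I_N -> sphere R -> sphere R)
    (w : word N) : sphere R -> sphere R :=
  foldl (fun g i => f i \o g) id w.

Definition total_degree (R : realType) (N : nat)
    (f : 'I_N -> sphere R -> sphere R) : nat :=
  (\sum_(i < N) degree (f i))%N.

(* The integral of [phi] against d^-n \sum_(g(z) = a, l(g) = n) \delta_z.     *)
Definition preimage_average (R : realType) (N : nat)
    (f : 'I_N -> sphere R -> sphere R) (a : sphere R) (phi : sphere R -> R)
    (n : nat) : R :=
  ((total_degree f)%:R ^+ n)^-1 *
  \sum_(w : n.-tuple 'I_N)
    \sum_(z \in word_map f w @^-1` [set a])
      (multiplicity (word_map f w) a z)%:R * phi z.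

(* At most one [mu] has this property, since any two exceptional sets [E]      *)
(* leave a common point [a] outside.                                          *)
Definition boyd_measure (R : realType) (N : nat)
    (f : 'I_N -> sphere R -> sphere R) (mu : probability (borel_sphere R) R) :
    Prop :=
  exists E : set (sphere R), (exists b c, E `<=` [set b; c]) /\
  forall a, ~ E a ->
  forall phi : sphere R -> R, continuous phi ->
  preimage_average f a phi n @[n --> \oo] --> (\int[mu]_x phi x)%R.

(* Main.v *)
Require Import Defs.
From mathcomp Require Import all_boot all_order all_algebra.
From mathcomp Require Import complex.
From mathcomp Require Import all_classical all_reals all_analysis.
From mathcomp Require Import measurable_realfun lra ring.
Import Order.TTheory GRing.Theory Num.Theory.
Import numFieldNormedType.Exports.

Set Implicit Arguments.
Unset Strict Implicit.
Unset Printing Implicit Defensive.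

Local Open Scope classical_set_scope.
Local Open Scope ring_scope.

(** Write [L phi y = d^-1 \sum_i \sum_(f_i(z) = y) phi(z)], preimages being
    counted once.  A rational map takes a value at most as many times as its
    degree, so [L] is positive, linear and [L 1 <= 1].  All but countably many
    points [a] are critical values of no word.  For such an [a] outside the
    exceptional set, the averages that define [mu] are at most [L^n phi (a)] for
    [phi >= 0] ([generic_point], [preimage_average_le]).  Hence
    [\int phi d mu <= liminf L^n phi (a)] for continuous [phi >= 0], and upper
    bounds on the integrals against [mu] follow from upper bounds on [L^n].

    The functions [L^n phi] are means over backward trajectories, and there
    Poincare's argument applies.  Let [V] be a set, [l >= 1], and let [H_m(y)]
    be the mass of the backward paths from [y] of length [l m] that end in [V]
    and avoid [V] at the earlier times [0, l, 2l, ...].  These events are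
    disjoint, so [\sum_m H_m <= 1], while [H_(m+1) <= L^l H_m].  Averaged over a
    long time, [L^n H_M] is therefore at most about [1/(M+1)]
    ([avoiding_mean_le]).  Read forwards: the paths that start in [V] and avoid
    [V] at the times [l, 2l, ..., Ml] have mass at most [1/(M+1)].

    One return for almost every point would not be enough, since its word may
    lead into a null set of points that do not return: the preimage of a null
    set under [f_i] need not be null.  So infinitely many returns are required
    along a single path.  Choose [M_j] with [\sum_j 1/(M_j+1) <= e] and then
    [l_j] so fast that the windows [{l_j, 2 l_j, ..., M_j l_j}] are successive.
    The points of [V] all of whose words of length [l_J] miss [V] during one of
    the first [J] windows have mass at most [e], for every [J]
    ([boyd_integral_le]).  For a closed set [K] this gives, by approximation
    with the closed neighbourhoods of [K], that up to measure [e] each point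
    of [K] has, for each [J], a word that visits [K] in each of the first [J]
    windows ([closed_always_misses]).  As there are finitely many words of each
    length, Koenig's lemma yields one infinite path that visits [K] in every
    window ([koenig], [recurrent_of_visits]).  Finally a Borel set is, up
    to small measure, a closed set ([closed_inner_regular]). *)

Local Notation normc := (@ComplexField.Normc.normc _).
Local Notation "x %:C" := (real_complex _ x) : ring_scope.

(** * The topology of the sphere *)

Lemma normE (R : realType) (z : R[i]) : `|z| = (normc z)%:C.
Proof. by []. Qed.

Lemma normc_ge0 (R : realType) (z : R[i]) : 0 <= normc z.
Proof. by rewrite -lecR -normE normr_ge0. Qed.

Lemma normc_triangle (R : realType) (z w : R[i]) :
  normc (z + w) <= normc z + normc w.
Proof. exact: le_normcD. Qed.

Lemma normc_distC (R : realType) (z w : R[i]) : normc (z - w) = normc (w - z).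
Proof. by rewrite -(normcN (w - z)) opprB. Qed.

(** The topology of [R[i]^o] is given by the [R[i]]-valued norm; this and
    [nbhs_infty] translate neighbourhoods into inequalities in [R]. *)
Lemma nbhs_plane (R : realType) (z : R[i]^o) (A : set R[i]^o) :
  nbhs z A <->
  exists2 r : R, 0 < r & forall w : R[i]^o, normc (w - z) < r -> A w.
Proof.
split.
  move=> /nbhs_ballP[[a b] /= e0 eA].
  move: e0; rewrite ltcE /= => /andP[/eqP b0 a0].
  exists a => // w wz; apply: eA.
  by rewrite /ball /= distrC normE ltcE /= b0 eqxx.
move=> [r r0 rA]; apply/nbhs_ballP; exists r%:C; first by rewrite /= ltcR.
by move=> w; rewrite /ball /= distrC normE ltcR; exact: rA.
Qed.

Lemma continuous_at_real (R : realType) (T : topologicalType) (f : T -> R)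
    (x : T) :
  (forall e : R, 0 < e -> nbhs x [set y | `|f x - f y| < e]) ->
  f @ x --> f x.
Proof. by move=> fx; apply/cvgrPdist_lt. Qed.

Lemma continuous_normc (R : realType) : continuous (normc : R[i]^o -> R).
Proof.
move=> z; apply: continuous_at_real => e e0.
apply/nbhs_plane; exists e => // w wz /=.
rewrite ltr_distlC.
have := normc_triangle (w - z) z; have := normc_triangle (z - w) w.
rewrite !subrK (normc_distC z w) => h1 h2.
by apply/andP; split; lra.
Qed.

Lemma normc_le_norm1 (R : realType) (a b : R) :
  normc (Complex a b) <= `|a| + `|b|.
Proof.
rewrite /= -(@ler_pXn2r _ 2) ?nnegrE ?sqrtr_ge0 ?addr_ge0 //.
rewrite sqr_sqrtr ?addr_ge0 ?sqr_ge0 // sqrrD !real_normK ?num_real //.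
by rewrite lerD2r lerDl mulrn_wge0 // mulr_ge0.
Qed.

Lemma norm_le_normc (R : realType) (a b : R) :
  `|a| <= normc (Complex a b) /\ `|b| <= normc (Complex a b).
Proof.
by split; rewrite /= -sqrtr_sqr ler_wsqrtr // ?lerDl ?lerDr sqr_ge0.
Qed.

(** The disc is closed in the image of the square [[-r, r]^2]. *)
Lemma closed_disc_compact (R : realType) (r : R) :
  compact [set z : R[i]^o | normc z <= r].
Proof.
pose g (p : R * R) : R[i]^o := Complex p.1 p.2.
have cg : continuous g.
  move=> [x y] A /= /nbhs_plane[e e0 eA].
  have e2 : 0 < e / 2 by rewrite divr_gt0.
  exists (ball x (e / 2), ball y (e / 2)).
    by split; exact: nbhsx_ballx.
  move=> [x' y'] /= [xx' yy']; apply: eA.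
  have -> : g (x', y') - g (x, y) = Complex (x' - x) (y' - y) by [].
  apply: le_lt_trans (normc_le_norm1 _ _) _.
  by rewrite (splitr e) ltrD // distrC.
apply: (@subclosed_compact _ _ (g @` (`[-r, r] `*` `[-r, r]))).
- apply: (@preimage_closed _ _ (normc : R[i]^o -> R) [set x | x <= r]).
    by move=> z _; exact: continuous_normc.
  exact: closed_le.
- apply: continuous_compact; first exact/continuous_subspaceT.
  by apply: compact_setX; exact: segment_compact.
- move=> [x y] /= xy; exists (x, y) => //=.
  have [h1 h2] := norm_le_normc x y.
  by rewrite /= !in_itv /= -!ler_norml (le_trans h1 xy) (le_trans h2 xy).
Qed.

Lemma nbhs_infty (R : realType) (A : set (sphere R)) :
  nbhs (None : sphere R) A <->
  A None /\ exists r : R, forall w : R[i]^o, r < normc w -> A (Some w).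
Proof.
split.
  move=> [U [cU clU] UA]; split; first by apply: UA; right.
  have : compact ((normc : R[i]^o -> R) @` U).
    apply: continuous_compact => //; apply/continuous_subspaceT.
    exact: continuous_normc.
  move=> /compact_bounded [M [_ /(_ (M + 1))]].
  rewrite ltrDl ltr01 => /(_ isT) bM.
  exists (M + 1) => w rw; apply: UA; left; exists w => // Uw.
  have /= := bM (normc w); rewrite ger0_norm ?normc_ge0 //.
  by move=> /(_ (ex_intro2 _ _ w Uw erefl)); rewrite leNgt rw.
move=> [AN [r rA]].
exists [set z : R[i]^o | normc z <= r].
  split; first exact: closed_disc_compact.
  apply: (@preimage_closed _ _ (normc : R[i]^o -> R) [set x | x <= r]).
    by move=> z _; exact: continuous_normc.
  exact: closed_le.
move=> x [[z /= /negP zr <-]|/= -> //].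
by apply: rA; rewrite ltNge.
Qed.

(** The distance to the complement of [O], truncated at 1; the truncation also
    gives a value when that complement is empty. *)
Definition gap (R : realType) (O : set R[i]^o) (z : R[i]^o) : R :=
  inf ([set 1] `|` [set normc (z - w) | w in ~` O]).

Section Gap.
Variables (R : realType) (O : set R[i]^o).

Let distances (z : R[i]^o) : set R :=
  [set 1] `|` [set normc (z - w) | w in ~` O].

Let distances_lb z : lbound (distances z) 0.
Proof. by move=> _ [->|[w _ <-]]; rewrite ?ler01 ?normc_ge0. Qed.

Let distances_neq0 z : distances z !=set0.
Proof. by exists 1; left. Qed.

Lemma gap_ge0 z : 0 <= gap O z.
Proof. by apply: lb_le_inf; [exact: distances_neq0|exact: distances_lb]. Qed.

Lemma gap_le1 z : gap O z <= 1.
Proof. by apply: ge_inf; [exists 0; exact: distances_lb|left]. Qed.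

Lemma gap_le_dist z w : ~ O w -> gap O z <= normc (z - w).
Proof.
by move=> Ow; apply: ge_inf; [exists 0; exact: distances_lb|right; exists w].
Qed.

Lemma gap_ge z r : r <= 1 -> (forall w, ~ O w -> r <= normc (z - w)) ->
  r <= gap O z.
Proof.
move=> r1 rO; apply: lb_le_inf; first exact: distances_neq0.
by move=> _ [->|[w /rO ? <-]].
Qed.

Lemma gap_lipschitz z w : gap O z <= gap O w + normc (z - w).
Proof.
rewrite -lerBlDr; apply: gap_ge.
  by rewrite lerBlDr (le_trans (gap_le1 z)) // lerDl normc_ge0.
move=> v /(gap_le_dist z) zv; rewrite lerBlDr (le_trans zv) //.
by have := normc_triangle (z - w) (w - v); rewrite addrA subrK [leRHS]addrC.
Qed.

Lemma continuous_gap : continuous (gap O).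
Proof.
move=> z; apply: continuous_at_real => e e0.
apply/nbhs_plane; exists e => // w wz /=.
have := gap_lipschitz z w; have := gap_lipschitz w z.
by rewrite (normc_distC z w) ltr_distlC => h1 h2; apply/andP; split; lra.
Qed.

Lemma gap_gt0 z : open O -> O z -> 0 < gap O z.
Proof.
move=> oO Oz; have /nbhs_plane[r r0 rO] : nbhs z O by exact: open_nbhs_nbhs.
apply: (@lt_le_trans _ _ (Num.min r 1)); first by rewrite lt_min r0 ltr01.
apply: gap_ge => [|w Ow]; first by rewrite ge_min lexx orbT.
rewrite ge_min; apply/orP; left; rewrite leNgt normc_distC.
by apply/negP => /rO.
Qed.

Lemma gap_eq0 z : ~ O z -> gap O z = 0.
Proof.
move=> Oz; apply/eqP; rewrite eq_le gap_ge0 andbT.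
by rewrite (le_trans (gap_le_dist z Oz)) // subrr ComplexField.Normc.normc0.
Qed.

End Gap.

(** Off infinity, [gap] is the required function.  If [O] contains infinity,
    then its complement is bounded and [gap] equals 1 near infinity.  If not,
    the factor [1 / (1 + |z|)] forces the limit 0 at infinity. *)
Lemma sphere_cozero (R : realType) (O : set (sphere R)) : open O ->
  exists psi : sphere R -> R,
    [/\ continuous psi, forall x, 0 <= psi x & forall x, 0 < psi x <-> O x].
Proof.
move=> oO; pose O' : set R[i]^o := Some @^-1` O.
have oO' : open O'.
  have /continuousP := @one_point_compactification_some_continuous R[i]^o.
  exact.
have [ON|ON] := pselect (O None).
- pose psi (x : sphere R) := if x is Some z then gap O' z else 1.
  have : nbhs (None : sphere R) O by exact: open_nbhs_nbhs.
  move=> /nbhs_infty[_ [r rO]].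
  exists psi; split.
  + move=> [z|].
      move=> A /continuous_gap; exact.
    apply: continuous_at_real => e e0; apply/nbhs_infty; split.
      by rewrite /= subrr normr0.
    exists (r + 1) => w rw /=.
    suff -> : gap O' w = 1 by rewrite subrr normr0.
    apply/eqP; rewrite eq_le gap_le1; apply: gap_ge => // v Ov.
    have vr : normc v <= r by rewrite leNgt; apply/negP => /rO.
    by have := normc_triangle (w - v) v; rewrite subrK => h; lra.
  + by move=> [z|] /=; rewrite ?gap_ge0 ?ler01.
  + move=> [z|] /=; last by split=> // _; exact: ltr01.
    split; last exact: gap_gt0.
    move=> z0; apply: contrapT => /(@gap_eq0 _ O') z1.
    by move: z0; rewrite z1 ltxx.
- pose psi (x : sphere R) :=
    if x is Some z then gap O' z / (1 + normc z) else 0.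
  have p1 (z : R[i]) : 0 < 1 + normc z by rewrite ltr_pwDl // normc_ge0.
  exists psi; split.
  + move=> [z|].
      suff : (fun z : R[i]^o => gap O' z / (1 + normc z)) @ z -->
             gap O' z / (1 + normc z) by move=> h A /h.
      apply: (cvgM (@continuous_gap R O' z)).
      apply: cvgV; first by rewrite gt_eqF.
      exact: (cvgD (cvg_cst (1 : R)) (@continuous_normc R z)).
    apply: continuous_at_real => e e0; apply/nbhs_infty; split.
      by rewrite /= subrr normr0.
    exists (e^-1) => w rw /=.
    rewrite sub0r normrN ger0_norm; last by rewrite divr_ge0 ?gap_ge0 // ltW.
    rewrite ltr_pdivrMr //; apply: le_lt_trans (gap_le1 _ _) _.
    by rewrite -ltr_pdivrMl // mulr1 (lt_le_trans rw) // lerDr.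
  + by move=> [z|] //=; rewrite divr_ge0 ?gap_ge0 // ltW.
  + move=> [z|] /=; last by rewrite ltxx.
    rewrite pmulr_lgt0 ?invr_gt0 //; split; last exact: gap_gt0.
    move=> z0; apply: contrapT => /(@gap_eq0 _ O') z1.
    by move: z0; rewrite z1 ltxx.
Qed.

(** * Rational maps are continuous *)

Definition sphere_quo (R : realType) (a b : R[i]^o) : sphere R :=
  if b == 0 then None else Some (a / b).

(** Continuity of division as a map to the sphere, on pairs other than (0, 0);
    it covers zeros of the denominator and, after a change of coordinate, the
    point at infinity. *)
Lemma cvg_sphere_quo (R : realType) (T : Type) (F : set_system T)
    (u v : T -> R[i]^o) (a b : R[i]^o) {FF : Filter F} :
  u @ F --> a -> v @ F --> b -> (a != 0) || (b != 0) ->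
  (fun t => sphere_quo (u t) (v t)) @ F --> sphere_quo a b.
Proof.
move=> ua vb ab; have [b0|bn0] := eqVneq b 0.
- rewrite b0 eqxx orbF in ab.
  have na : 0 < normc a.
    rewrite lt_neqAle normc_ge0 andbT eq_sym.
    by apply: contra ab => /eqP/ComplexField.Normc.eq0_normc ->.
  rewrite /sphere_quo b0 eqxx => A /nbhs_infty[AN [r rA]].
  have /ua Fu : nbhs a [set w | normc (w - a) < normc a / 2].
    by apply/nbhs_plane; exists (normc a / 2) => //; rewrite divr_gt0.
  (* If |u| > |a| / 2 and |v| < e, then |u / v| > |r| + 1. *)
  pose e := normc a / 2 / (`|r| + 1).
  have r1 : 0 < `|r| + 1 by rewrite ltr_pwDr.
  have /vb Fv : nbhs b [set w | normc (w - b) < e].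
    by apply/nbhs_plane; exists e => //; rewrite !divr_gt0.
  suff h : \forall t \near F, A (sphere_quo (u t) (v t)) by exact: h.
  near=> t; rewrite /sphere_quo; have [//|vt] := eqVneq (v t) 0.
  apply: rA.
  have h1 : normc (u t - a) < normc a / 2 by near: t; exact: Fu.
  have h2 : normc (v t) < e by rewrite -[v t]subr0 -b0; near: t; exact: Fv.
  have vt0 : 0 < normc (v t).
    rewrite lt_neqAle normc_ge0 andbT eq_sym.
    by apply: contra vt => /eqP/ComplexField.Normc.eq0_normc ->.
  have h3 : normc a / 2 < normc (u t).
    have := normc_triangle (a - u t) (u t); rewrite subrK normc_distC; lra.
  rewrite ComplexField.Normc.normcM ComplexField.Normc.normcV ltr_pdivlMr //.
  apply: le_lt_trans h3; apply: le_trans (ler_norm _) _.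
  rewrite normrM (gtr0_norm vt0).
  apply: (@le_trans _ _ ((`|r| + 1) * e)).
    by apply: ler_pM => //; [exact: ltW|rewrite lerDl|exact: ltW].
  by rewrite /e mulrC divfK // gt_eqF.
- rewrite {2}/sphere_quo (negbTE bn0).
  have bn : 0 < normc b.
    rewrite lt_neqAle normc_ge0 andbT eq_sym.
    by apply: contra bn0 => /eqP/ComplexField.Normc.eq0_normc ->.
  have vn0 : \forall t \near F, v t != 0.
    suff /vb : nbhs b [set w : R[i]^o | w != 0] by [].
    apply/nbhs_plane; exists (normc b) => //.
    by move=> w; apply: contraTN => /eqP ->; rewrite sub0r normcN ltxx.
  have uv : (fun t => u t / v t : R[i]^o) @ F --> (a / b : R[i]^o).
    exact: (cvgM ua (cvgV bn0 vb)).
  move=> A /uv FA.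
  suff h : \forall t \near F, A (sphere_quo (u t) (v t)) by exact: h.
  near=> t.
  rewrite /sphere_quo ifN; last by near: t.
  by near: t.
Unshelve. all: by end_near.
Qed.

Lemma continuous_poly (R : realType) (p : {poly R[i]}) :
  continuous (fun z : R[i]^o => p.[z] : R[i]^o).
Proof.
elim/poly_ind: p => [|p c ih].
  have -> : (fun z : R[i]^o => (0 : {poly R[i]}).[z] : R[i]^o) = cst 0.
    by apply/funext => z; rewrite horner0.
  exact: cst_continuous.
have -> : (fun z : R[i]^o => (p * 'X + c%:P).[z] : R[i]^o) =
          (fun z => p.[z] * z + c).
  by apply/funext => z; rewrite hornerMXaddC.
move=> z.
exact: (cvgD (cvgM (ih z) (@cvg_id _ (nbhs z))) (cvg_cst (c : R[i]^o))).
Qed.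

(** The coordinate [1/z] near infinity. *)
Definition sphere_inv (R : realType) (x : sphere R) : R[i]^o :=
  if x is Some z then (z : R[i])^-1 else 0.

Lemma sphere_inv_cvg0 (R : realType) :
  @sphere_inv R @ (None : sphere R) --> (0 : R[i]^o).
Proof.
move=> A /nbhs_plane[e e0 eA]; apply/nbhs_infty; split.
  by apply: eA; rewrite subr0 ComplexField.Normc.normc0.
exists e^-1 => w ew; apply: eA; rewrite subr0 /= ComplexField.Normc.normcV.
by rewrite invf_plt // posrE (lt_trans _ ew) ?invr_gt0.
Qed.

(** [z^n p(1/z)]. *)
Definition reversed_poly (R : realType) (n : nat) (p : {poly R[i]}) :
  {poly R[i]} := \poly_(i < n.+1) p`_(n - i).

Lemma horner_reversed_poly (R : realType) n (p : {poly R[i]}) (z : R[i]) :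
  (size p <= n.+1)%N -> z != 0 ->
  (reversed_poly n p).[z^-1] = p.[z] / z ^+ n.
Proof.
move=> pn z0; rewrite horner_poly (horner_coef_wide _ pn) mulr_suml.
rewrite (reindex_inj rev_ord_inj) /=; apply: eq_bigr => i _.
have iN : (i <= n)%N by rewrite -ltnS.
rewrite subSS subKn // -mulrA; congr (_ * _).
have -> : z ^+ n = z ^+ (n - i) * z ^+ i by rewrite -exprD subnK.
by rewrite exprVn invfM mulrCA divff ?expf_neq0 ?mulr1.
Qed.

Lemma reversed_poly_at0 (R : realType) n (p : {poly R[i]}) :
  (reversed_poly n p).[0] = p`_n.
Proof. by rewrite horner_coef0 coef_poly subn0. Qed.

Lemma coprimep_neq0 (F : fieldType) (p q : {poly F}) :
  coprimep p q -> (p != 0) || (q != 0).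
Proof.
move=> pq; case: eqP => //= p0; case: eqP => // q0.
by move: pq; rewrite p0 q0 coprime0p -size_poly_eq1 size_poly0.
Qed.

Lemma coprimep_top (R : realType) (pq : {poly R[i]} * {poly R[i]}) :
  coprimep pq.1 pq.2 ->
  (pq.1`_(pair_degree pq) != 0) || (pq.2`_(pair_degree pq) != 0).
Proof.
move=> /coprimep_neq0; rewrite /pair_degree -!size_poly_gt0 => h.
have top (p : {poly R[i]}) : (0 < size p)%N -> p`_(size p).-1 != 0.
  by rewrite -lead_coefE lead_coef_eq0 -size_poly_gt0.
apply/orP; move: h; case: (leqP (size pq.1) (size pq.2)) => [le12|lt21] h.
  by right; apply: top; case/orP: h => // /leq_trans; apply.
by left; apply: top; exact: leq_ltn_trans lt21.
Qed.

Lemma size_le_pair_degree (R : realType) (pq : {poly R[i]} * {poly R[i]}) :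
  (size pq.1 <= (pair_degree pq).+1)%N /\ (size pq.2 <= (pair_degree pq).+1)%N.
Proof.
rewrite /pair_degree; split; apply: leq_trans (leqSpred _).
  exact: leq_maxl.
exact: leq_maxr.
Qed.

(** Near infinity, dividing numerator and denominator by [z^D] turns them into
    polynomials in [1/z] whose constant terms are the coefficients of degree
    [D], which do not both vanish. *)
Lemma continuous_rational_map (R : realType) (g : sphere R -> sphere R) :
  rational_map g -> continuous g.
Proof.
move=> [[p q] [/= pq ->]] [z|].
  suff : (fun z : R[i]^o => sphere_quo p.[z] q.[z]) @ z -->
         sphere_quo p.[z] q.[z] by move=> h A /h.
  apply: (cvg_sphere_quo (@continuous_poly R p z) (@continuous_poly R q z)).
  apply/norP => -[/negPn pz /negPn qz].
  by have := coprimep_root pq pz; rewrite (eqP qz) eqxx.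
set D := pair_degree (p, q).
have [sp sq] := size_le_pair_degree (p, q).
have lim (r : {poly R[i]}) :
    (fun x => (reversed_poly D r).[sphere_inv x] : R[i]^o) @ (None : sphere R)
    --> (r`_D : R[i]^o).
  rewrite -reversed_poly_at0.
  apply: (cvg_comp _ _ (@sphere_inv_cvg0 R)).
  exact: (@continuous_poly R (reversed_poly D r) 0).
have := cvg_sphere_quo (lim p) (lim q) (coprimep_top (pq := (p, q)) pq).
move=> key A /key; rewrite /= !nbhs_simpl /= => /nbhs_infty[A0 [r rA]].
apply/nbhs_infty; split.
  by move: A0; rewrite /= !reversed_poly_at0.
exists (Num.max r 0) => w; rewrite gt_max => /andP[rw w0] /=.
have wn0 : w != 0.
  by apply: contraTN w0 => /eqP ->; rewrite ComplexField.Normc.normc0 ltxx.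
have := rA _ rw; rewrite /= !horner_reversed_poly // /sphere_quo.
rewrite mulf_eq0 invr_eq0 (negbTE (expf_neq0 _ wn0)) orbF.
by case: ifP => // qw; rewrite invfM invrK mulrACA mulVf ?expf_neq0 ?mulr1.
Qed.

(** * Fibers and critical values *)

Lemma reduced_pairP (R : realType) (g : sphere R -> sphere R) :
  rational_map g -> represents g (reduced_pair g).
Proof.
move=> rg; have [pq gpq] := rg.
exact: (@xgetPex _ (0, 1) [set pq | represents g pq]) .
Qed.

Lemma deriv_eq0_size (R : realType) (p : {poly R[i]}) :
  p^`() = 0 -> (size p <= 1)%N.
Proof.
move=> p0; apply/leq_sizeP => -[//|j _].
have /eqP := coef_deriv p j; rewrite p0 coef0 eq_sym mulrn_eq0.
by move=> /eqP.
Qed.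

(** If the Wronskian vanishes, [p] divides [p' q], hence [p'], so that [p' = 0];
    likewise for [q]. *)
Lemma wronskian_neq0 (R : realType) (p q : {poly R[i]}) :
  coprimep p q -> (1 < maxn (size p) (size q))%N ->
  p^`() * q - p * q^`() != 0.
Proof.
have dvd0 (a b : {poly R[i]}) : coprimep a b ->
    a^`() * b = a * b^`() -> (size a <= 1)%N.
  move=> ab e; apply: deriv_eq0_size.
  have : a %| a^`() by rewrite -(Gauss_dvdpl _ ab) e dvdp_mulIl.
  have [->|a0] := eqVneq a 0; first by rewrite deriv0.
  have [//|a'0] := eqVneq a^`() 0.
  by move=> /(dvdp_leq a'0); rewrite leqNgt lt_size_deriv.
move=> pq; apply: contraTN; rewrite subr_eq0 => /eqP e.
rewrite -leqNgt geq_max (dvd0 p q) //=.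
by apply: (dvd0 q p); [rewrite coprimep_sym|rewrite mulrC -e mulrC].
Qed.

Lemma finite_roots (R : realType) (p : {poly R[i]}) : p != 0 ->
  exists2 r : seq R[i], uniq r /\ (size r < size p)%N &
  forall z, root p z = (z \in r).
Proof.
move=> p0; have [r pr] := closed_field_poly_normal p.
have rE z : root p z = (z \in undup r).
  by rewrite mem_undup pr rootZ ?lead_coef_eq0 // root_prod_XsubC.
exists (undup r) => //; split; first exact: undup_uniq.
apply: max_poly_roots => //; last exact: undup_uniq.
by apply/allP => z; rewrite rE.
Qed.

Section Fiber.
Variables (R : realType) (g : sphere R -> sphere R).
Hypothesis rg : rational_map g.
Hypothesis dg : (0 < degree g)%N.

Let p := (reduced_pair g).1.
Let q := (reduced_pair g).2.
Let pq : coprimep p q. Proof. by have [] := reduced_pairP rg. Qed.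
Let gE : g = pair_map (reduced_pair g).
Proof. by have [] := reduced_pairP rg. Qed.

Let gSome (z : R[i]) :
  g (Some z) = if q.[z] == 0 then None else Some (p.[z] / q.[z]).
Proof. by rewrite {1}gE. Qed.

Let gNone : g None =
  if q`_(degree g) == 0 then None else Some (p`_(degree g) / q`_(degree g)).
Proof. by rewrite {1}gE. Qed.

Let size_gt1 : (1 < maxn (size p) (size q))%N.
Proof. by move: dg; rewrite /degree /pair_degree; case: maxn => [|[|]]. Qed.

Lemma size_fiber_poly a : (size (fiber_poly g a) <= (degree g).+1)%N.
Proof.
have hp : (size p <= (degree g).+1)%N.
  by rewrite /degree /pair_degree (leq_trans _ (leqSpred _)) // leq_maxl.
have hq : (size q <= (degree g).+1)%N.
  by rewrite /degree /pair_degree (leq_trans _ (leqSpred _)) // leq_maxr.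
case: a => [c|//]; rewrite /fiber_poly (leq_trans (size_polyD _ _)) //.
by rewrite geq_max hp size_polyN (leq_trans (size_scale_leq _ _)).
Qed.

Lemma fiber_poly_neq0 a : fiber_poly g a != 0.
Proof.
have key (b : {poly R[i]}) : b %| p -> b %| q -> (size b <= 1)%N.
  by move=> bp bq; rewrite (eqp_size (coprimepP _ _ pq b bp bq)) size_poly1.
case: a => [c|] /=; apply/eqP.
- move=> /eqP; rewrite subr_eq0 => /eqP pcq.
  have sq : (size q <= 1)%N.
    by apply: key => //; rewrite /p pcq -mul_polyC dvdp_mull.
  have sp : (size p <= 1)%N.
    by rewrite /p pcq (leq_trans (size_scale_leq _ _)).
  by move: size_gt1; rewrite ltnNge geq_max sp sq.
- move=> q0; have sp : (size p <= 1)%N by apply: key => //; rewrite /q q0 dvdp0.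
  by move: size_gt1; rewrite /q q0 size_poly0 maxn0 ltnNge sp.
Qed.

Lemma fiber_root a z : g (Some z) = a -> root (fiber_poly g a) z.
Proof.
rewrite gSome; case: ifPn => [/eqP qz <-|qz <-].
  by rewrite rootE; apply/eqP.
by rewrite /fiber_poly rootE hornerD hornerN hornerZ -/p -/q divfK // subrr.
Qed.

Lemma fiber_infty a : g None = a -> (fiber_poly g a)`_(degree g) = 0.
Proof.
rewrite gNone; case: ifPn => [/eqP qz <- //|qz <-].
by rewrite /fiber_poly coefB coefZ -/p -/q divfK // subrr.
Qed.

(** Finite solutions are roots of the fiber polynomial.  If infinity is a
    solution too, the degree of that polynomial drops, which makes room for
    it. *)
Lemma fiber_seq a : exists s : seq (sphere R),
  [/\ uniq s, (size s <= degree g)%N & g @^-1` [set a] = [set` s]].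
Proof.
have [r [ur sr] rE] := finite_roots (fiber_poly_neq0 a).
pose s1 := [seq (Some z : sphere R) | z <- r & g (Some z) == a].
exists (s1 ++ (if g None == a then [:: None : sphere R] else [::])).
have us1 : uniq s1.
  by rewrite map_inj_uniq ?filter_uniq // => x y [].
have ss1 : (size s1 <= size r)%N by rewrite size_map size_filter count_size.
have N1 : (None : sphere R) \notin s1 by apply/mapP => -[].
split.
- by rewrite cat_uniq us1; case: ifP => //= _; rewrite orbF N1.
- rewrite size_cat; case: ifP => [/eqP /fiber_infty ga|_] /=; last first.
    rewrite addn0 -ltnS (leq_ltn_trans ss1) // (leq_trans sr) //.
    exact: size_fiber_poly.
  rewrite addn1 (leq_ltn_trans ss1) // (leq_trans sr) //.
  apply/leq_sizeP => j; rewrite leq_eqVlt => /predU1P[<- //|].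
  by move=> /(leq_trans (size_fiber_poly a)) /leq_sizeP; apply.
- apply/seteqP; split => [[z|]|[z|]] /=; rewrite mem_cat.
  + move=> gz; apply/orP; left; apply/mapP; exists z => //.
    by rewrite mem_filter gz eqxx -rE fiber_root.
  + by move=> ->; rewrite eqxx inE eqxx orbT.
  + move=> /orP[/mapP[w]|]; last by case: ifP.
    by rewrite mem_filter => /andP[/eqP <- _] [->].
  + by rewrite (negbTE N1) /=; case: ifP => // /eqP.
Qed.

(** A multiple root of [p - c q] is a root of the Wronskian of [p] and [q].  The
    value at infinity is discarded, so that no multiplicity at infinity has to
    be examined. *)
Lemma finite_critical_values : exists2 bad : set (sphere R), finite_set bad &
  forall a, ~ bad a -> forall z, g z = a -> (multiplicity g a z <= 1)%N.
Proof.
have [r [ur sr] rE] := finite_roots (wronskian_neq0 pq size_gt1).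
exists ([set None; g None] `|` [set g (Some z) | z in [set` r]]).
  rewrite !finite_setU; split; first by split; exact: finite_set1.
  by apply: finite_image; exact: finite_seq.
move=> a nbad [z|] ga; last by case: nbad; left; right.
case: a nbad ga => [c|] nbad ga; last by case: nbad; left; left.
rewrite /multiplicity mup_leq ?fiber_poly_neq0 //.
apply/negP; rewrite /fiber_poly -/p -/q => /dvdpP[h hE].
case: nbad; right; exists z => //=; rewrite -rE rootE.
have e1 : p.[z] - c * q.[z] = 0.
  have := congr1 (fun u : {poly R[i]} => u.[z]) hE.
  by rewrite hornerD hornerN hornerZ => ->;
    rewrite hornerM horner_exp hornerXsubC subrr expr0n mulr0.
have e2 : p^`().[z] - c * q^`().[z] = 0.
  have := congr1 (fun u : {poly R[i]} => u^`().[z]) hE.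
  rewrite /= derivB derivZ hornerD hornerN hornerZ => ->.
  by rewrite expr2 !derivM !(hornerD, hornerM, hornerN, hornerX, hornerC) subrr;
    rewrite !(mul0r, mulr0, addr0).
rewrite !hornerE; apply/eqP.
move/eqP: e1; rewrite subr_eq0 => /eqP ->; move/eqP: e2.
by rewrite subr_eq0 => /eqP ->; ring.
Qed.

End Fiber.

(** * Recurrence for sub-Markov operators *)

Lemma sum_shift_le (R : realType) (a : nat -> R) (K t S : nat) :
  (t <= S)%N -> (forall n, 0 <= a n) ->
  \sum_(n < K) a (n + t)%N <= \sum_(n < K + S) a n.
Proof.
move=> tS a0; have -> : (K + S = t + (K + (S - t)))%N.
  by rewrite addnCA subnKC.
rewrite !big_split_ord /=; under eq_bigr do rewrite addnC.
by rewrite -[leLHS]addr0 addrCA lerD2l addr_ge0 // sumr_ge0.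
Qed.

(** Positive linear operators that do not increase the constant 1.  The domain
    consists of all functions, so measurability never arises. *)
Definition sub_markov (R : realType) (X : Type) (L : (X -> R) -> X -> R) :=
  [/\ forall phi psi, L (phi \+ psi) = L phi \+ L psi,
      forall c phi, L (fun x => c * phi x) = (fun x => c * L phi x),
      forall phi psi, (forall x, phi x <= psi x) -> forall x, L phi x <= L psi x
    & forall x, L (cst 1) x <= 1].

Section SubMarkov.
Variables (R : realType) (X : Type) (L : (X -> R) -> X -> R).
Hypothesis mL : sub_markov L.

Lemma sub_markov_iter n : sub_markov (iter n L).
Proof.
have [LD LZ Lle L1] := mL.
split.
- by elim: n => [//|n ih] phi psi; rewrite !iterS ih LD.
- by elim: n => [//|n ih] c phi; rewrite !iterS ih LZ.
- by elim: n => [//|n ih] phi psi le x; rewrite !iterS; exact/Lle/ih.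
- elim: n => [//|n ih] x; rewrite iterS.
  by apply: le_trans (L1 x); exact: Lle.
Qed.

Lemma sub_markov0 : L (cst 0) = cst 0.
Proof.
have [_ LZ _ _] := mL.
have := LZ 0 (cst 0); under eq_fun do rewrite mul0r.
by move=> ->; under eq_fun do rewrite mul0r.
Qed.

Lemma sub_markov_ge0 phi : (forall x, 0 <= phi x) -> forall x, 0 <= L phi x.
Proof.
have [_ _ Lle _] := mL.
move=> p0 x; have := Lle (cst 0) phi p0 x.
by rewrite sub_markov0.
Qed.

Lemma sub_markov_le1 phi : (forall x, phi x <= 1) -> forall x, L phi x <= 1.
Proof.
by have [_ _ Lle L1] := mL; move=> p1 x; apply: le_trans (L1 x); exact: Lle.
Qed.

Lemma sub_markov_sum (I : Type) (r : seq I) (F : I -> X -> R) :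
  L (fun x => \sum_(i <- r) F i x) = fun x => \sum_(i <- r) L (F i) x.
Proof.
have [LD _ _ _] := mL.
elim: r => [|i r ih].
  under eq_fun do rewrite big_nil.
  by rewrite [LHS]sub_markov0; apply/funext => x; rewrite big_nil.
under eq_fun do rewrite big_cons.
rewrite [LHS](LD (F i) (fun x => \sum_(j <- r) F j x)) ih.
by apply/funext => x; rewrite big_cons.
Qed.

End SubMarkov.

Section Recurrence.
Variables (R : realType) (X : Type) (L : (X -> R) -> X -> R).
Hypothesis mL : sub_markov L.
Variables (c q : X -> R).
Hypothesis c0 : forall x, 0 <= c x.
Hypothesis q0 : forall x, 0 <= q x.
Hypothesis cq1 : forall x, c x + q x <= 1.
Variable l : nat.

Let P := iter l L.
Let mP : sub_markov P := sub_markov_iter mL l.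

(** For [c] and [q] the indicators of [V] and of its complement: the mass of the
    backward paths of length [l * m] that end in [V] and avoid [V] at the times
    [0, l, ..., l * (m - 1)]. *)
Definition avoiding (m : nat) : X -> R :=
  iter m (fun phi x => q x * iter l L phi x) c.

Lemma avoiding_ge0 m x : 0 <= avoiding m x.
Proof.
elim: m x => [//|m ih] x; rewrite /avoiding iterS mulr_ge0 //.
exact: (sub_markov_ge0 mP).
Qed.

(** The disjointness of the times of first visit, as an induction: the partial
    sum [u] becomes [c + q * L^l u <= c + q <= 1]. *)
Lemma sum_avoiding_le1 n x : \sum_(m < n) avoiding m x <= 1.
Proof.
elim: n x => [|n ih] x; first by rewrite big_ord0 ler01.
rewrite big_ord_recl (eq_bigr (fun i : 'I_n => q x * P (avoiding i) x)) //.
rewrite -mulr_sumr.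
have := congr1 (fun h => h x)
  (sub_markov_sum mP (index_enum 'I_n) (fun m : 'I_n => avoiding m)).
move=> /= <-; apply: le_trans (cq1 x); rewrite lerD2l ler_piMr //.
exact: (sub_markov_le1 mP).
Qed.

Lemma avoidingS_le m x : avoiding m.+1 x <= iter l L (avoiding m) x.
Proof.
rewrite {1}/avoiding iterS ler_piMl //.
  by apply: (sub_markov_ge0 mP) => y; exact: avoiding_ge0.
by apply: le_trans (cq1 x); rewrite lerDr.
Qed.

Lemma iter_avoiding_le n m k x :
  iter n L (avoiding (m + k)) x <= iter (n + l * k) L (avoiding m) x.
Proof.
elim: k n x => [|k ih] n x; first by rewrite muln0 !addn0.
rewrite addnS mulnS addnA; apply: le_trans (ih _ _).
rewrite iterD; have [_ _ Lle _] := sub_markov_iter mL n.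
by apply: Lle => y; exact: avoidingS_le.
Qed.

(** Each of the [M + 1] terms [avoiding m], shifted in time by [l * (M - m)],
    dominates [avoiding M]; together they have mass at most 1 at each time. *)
Lemma avoiding_mean_le (s M K : nat) x :
  M.+1%:R * \sum_(n < K) iter (s + n) L (avoiding M) x <= (K + l * M)%:R.
Proof.
pose a m n := iter (s + n) L (avoiding m) x.
have a0 m n : 0 <= a m n.
  apply: (sub_markov_ge0 (sub_markov_iter mL _)) => y; exact: avoiding_ge0.
have -> : M.+1%:R * \sum_(n < K) iter (s + n) L (avoiding M) x =
          \sum_(m < M.+1) \sum_(n < K) a M n.
  by rewrite sumr_const card_ord mulr_natl.
apply: (@le_trans _ _ (\sum_(m < M.+1) \sum_(n < K + l * M) a m n)).
  apply: ler_sum => m _.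
  have mM : (m <= M)%N by rewrite -ltnS.
  apply: (@le_trans _ _ (\sum_(n < K) a m (n + l * (M - m))%N)).
    apply: ler_sum => n _.
    by have := iter_avoiding_le (s + n) m (M - m) x; rewrite subnKC // -addnA.
  by apply: sum_shift_le => //; rewrite leq_mul2l leq_subr orbT.
rewrite exchange_big /=.
apply: (@le_trans _ _ (\sum_(n < K + l * M) 1)).
  apply: ler_sum => n _.
  have := congr1 (fun h => h x) (sub_markov_sum (sub_markov_iter mL (s + n))
    (index_enum 'I_M.+1) (fun m : 'I_M.+1 => avoiding m)).
  rewrite /a /= => <-; apply: (sub_markov_le1 (sub_markov_iter mL _)) => y.
  exact: sum_avoiding_le1.
by rewrite sumr_const card_ord.
Qed.

End Recurrence.

(** * The transfer operator and means over paths *)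

Definition finite_to_one (X Y : choiceType) (g : X -> Y) :=
  forall y, finite_set (g @^-1` [set y]).

(** Sums over finite fibers are handled as sums over sequences. *)
Lemma finite_uniq_seq (T : choiceType) (A : set T) : finite_set A ->
  exists2 s : seq T, uniq s & A = [set` s].
Proof.
move=> /finite_seqP[s ->]; exists (undup s); first exact: undup_uniq.
by apply/seteqP; split => x /=; rewrite mem_undup.
Qed.

Lemma fiber_sum_comp (R : realType) (X Y Z : choiceType) (g : X -> Y)
    (h : Y -> Z) (phi : X -> R) (z : Z) :
  finite_to_one g -> finite_to_one h ->
  \sum_(x \in (h \o g) @^-1` [set z]) phi x =
  \sum_(y \in h @^-1` [set z]) \sum_(x \in g @^-1` [set y]) phi x.
Proof.
move=> fg fh; have fz := fh z.
have ffib : finite_set ((h \o g) @^-1` [set z]).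
  have -> : (h \o g) @^-1` [set z] =
      \bigcup_(y in h @^-1` [set z]) g @^-1` [set y].
    by apply/seteqP; split => [x /= hx|x [y /= hy ->]//]; exists (g x).
  exact: bigcup_finite.
have [r ur rE] := finite_uniq_seq ffib; have [s us sE] := finite_uniq_seq fz.
have rP x : (x \in r) = (h (g x) == z).
  apply/idP/eqP => hx; first by have : [set` r] x by []; rewrite -rE.
  by have : ((h \o g) @^-1` [set z]) x by []; rewrite rE.
have sP y : (y \in s) = (h y == z).
  apply/idP/eqP => hy; first by have : [set` s] y by []; rewrite -sE.
  by have : (h @^-1` [set z]) y by []; rewrite sE.
rewrite rE sE -!fsbig_seq //.
transitivity (\sum_(x <- r) \sum_(y <- s | y == g x) phi x).
  apply: eq_big_seq => x; rewrite rP => hx.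
  by rewrite -big_filter filter_pred1_uniq ?sP // big_seq1.
rewrite (exchange_big_dep xpredT) //=; apply: eq_big_seq => y.
rewrite sP => /eqP hy.
have -> : g @^-1` [set y] = [set` [seq x <- r | y == g x]].
  apply/seteqP; split => x /=; rewrite mem_filter rP.
    by move=> ->; rewrite hy !eqxx.
  by move=> /andP[/eqP ->].
by rewrite -big_filter fsbig_seq // filter_uniq.
Qed.

Section Transfer.
Variables (R : realType) (N : nat) (f : 'I_N -> sphere R -> sphere R).
Hypothesis rf : forall i, rational_map (f i).
Hypothesis df : forall i, (0 < degree (f i))%N.

Definition transfer (phi : sphere R -> R) (y : sphere R) : R :=
  (total_degree f)%:R^-1 * \sum_(i < N) \sum_(z \in f i @^-1` [set y]) phi z.

Lemma transfer_sub_markov : sub_markov transfer.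
Proof.
have d0 : 0 <= (total_degree f)%:R^-1 :> R by rewrite invr_ge0 ler0n.
split.
- move=> phi psi; apply/funext => y; rewrite /transfer /= -mulrDr.
  rewrite -big_split (eq_bigr (fun i : 'I_N =>
    \sum_(z \in f i @^-1` [set y]) phi z +
    \sum_(z \in f i @^-1` [set y]) psi z)) // => i _.
  have [s [us _ ->]] := fiber_seq (rf i) (df i) y.
  by rewrite -!fsbig_seq // big_split.
- move=> c phi; apply/funext => y.
  rewrite /transfer /= mulrCA [in RHS]mulr_sumr.
  rewrite (eq_bigr (fun i : 'I_N => c * \sum_(z \in f i @^-1` [set y]) phi z))
    // => i _.
  have [s [us _ ->]] := fiber_seq (rf i) (df i) y.
  by rewrite -!fsbig_seq // mulr_sumr.
- move=> phi psi le y; rewrite /transfer ler_wpM2l //; apply: ler_sum => i _.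
  have [s [us _ ->]] := fiber_seq (rf i) (df i) y.
  by rewrite -!fsbig_seq //; apply: ler_sum.
- move=> y; rewrite /transfer.
  have [->|dn0] := eqVneq (total_degree f) 0%N.
    by rewrite invr0 mul0r ler01.
  rewrite ler_pdivrMl ?ltr0n ?lt0n // mulr1 /total_degree natr_sum.
  apply: ler_sum => i _.
  have [s [us ss ->]] := fiber_seq (rf i) (df i) y.
  by rewrite -!fsbig_seq // big_const_seq count_predT iter_addr_0 /= ler_nat.
Qed.

(** The mean of [Phi w z] over the words [w] of length [n] and the points [z]
    with [word_map f w z = y], with the same weights as [transfer]. *)
Fixpoint path_mean (n : nat) (Phi : word N -> sphere R -> R) (y : sphere R)
    : R :=
  if n is m.+1 then
    (total_degree f)%:R^-1 * \sum_(i < N) \sum_(u \in f i @^-1` [set y])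
       path_mean m (fun w => Phi (rcons w i)) u
  else Phi [::] y.

Lemma word_map_rcons w i : word_map f (rcons w i) = f i \o word_map f w.
Proof. by rewrite /word_map foldl_rcons. Qed.

Lemma word_map_cat u v : word_map f (u ++ v) = word_map f v \o word_map f u.
Proof.
elim/last_ind: v => [|v i ih]; first by rewrite cats0.
by rewrite -rcons_cat !word_map_rcons ih.
Qed.

Lemma path_mean_le n Phi Psi y :
  (forall w z, size w = n -> word_map f w z = y -> Phi w z <= Psi w z) ->
  path_mean n Phi y <= path_mean n Psi y.
Proof.
elim: n Phi Psi y => [|n ih] Phi Psi y le /=; first exact: le.
rewrite ler_wpM2l ?invr_ge0 ?ler0n //; apply: ler_sum => i _.
have [s [us _ sE]] := fiber_seq (rf i) (df i) y.
rewrite sE -!fsbig_seq // big_seq [leRHS]big_seq; apply: ler_sum => u us'.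
apply: ih => w z sw wz; apply: le; first by rewrite size_rcons sw.
rewrite word_map_rcons /= wz.
by have : [set` s] u by []; rewrite -sE.
Qed.

Lemma path_mean_sum (I : Type) (r : seq I) n
    (Phi : I -> word N -> sphere R -> R) y :
  path_mean n (fun w z => \sum_(j <- r) Phi j w z) y =
        \sum_(j <- r) path_mean n (Phi j) y.
Proof.
elim: n Phi y => [//|n ih] Phi y /=.
rewrite -mulr_sumr exchange_big /=; congr (_ * _); apply: eq_bigr => i _.
have [s [us _ ->]] := fiber_seq (rf i) (df i) y.
rewrite -!fsbig_seq //; under [RHS]eq_bigr do rewrite -fsbig_seq //.
rewrite exchange_big /=; apply: eq_bigr => u _; exact: ih.
Qed.

Lemma path_meanZ n c Phi y :
  path_mean n (fun w z => c * Phi w z) y = c * path_mean n Phi y.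
Proof.
elim: n Phi y => [//|n ih] Phi y /=.
rewrite mulrCA [in RHS]mulr_sumr; apply: (congr1 (GRing.mul _)).
apply: eq_bigr => i _.
have [s [us _ ->]] := fiber_seq (rf i) (df i) y.
by rewrite -!fsbig_seq // mulr_sumr; apply: eq_bigr => u _; exact: ih.
Qed.

Lemma path_mean_transfer n phi y :
  path_mean n (fun _ z => phi z) y = iter n transfer phi y.
Proof.
elim: n y => [//|n ih] y; rewrite iterS /= /transfer.
congr (_ * _); apply: eq_bigr => i _; apply: eq_fsbigr => u _; exact: ih.
Qed.

(** [q n * L (q (n-1) * L (... L (q 0)))], the Feynman-Kac form of the mean of a
    product of functions of the successive points of a path. *)
Fixpoint weighted (q : nat -> sphere R -> R) (n : nat) : sphere R -> R :=
  if n is m.+1 then fun y => q n y * transfer (weighted q m) y else q 0%N.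

Lemma path_mean_prod (q : nat -> sphere R -> R) n y :
  (forall k x, 0 <= q k x) ->
  path_mean n (fun w z => \prod_(k < n.+1) q k (word_map f (take k w) z)) y <=
  weighted q n y.
Proof.
move=> q0; elim: n y => [|n ih] y; first by rewrite /= big_ord1.
rewrite [leRHS]/= /transfer mulrCA ler_wpM2l ?invr_ge0 ?ler0n //.
rewrite mulr_sumr; apply: ler_sum => i _.
have [s [us _ sE]] := fiber_seq (rf i) (df i) y.
rewrite sE -!fsbig_seq // mulr_sumr big_seq [leRHS]big_seq.
apply: ler_sum => u us'.
have fu : f i u = y by have : [set` s] u by []; rewrite -sE.
apply: (@le_trans _ _ (path_mean n (fun w z =>
    q n.+1 y * \prod_(k < n.+1) q k (word_map f (take k w) z)) u)).
  apply: path_mean_le => w z sw wz.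
  rewrite big_ord_recr /= take_oversize ?size_rcons ?sw //.
  rewrite word_map_rcons /= wz fu mulrC.
  rewrite le_eqVlt; apply/orP; left; apply/eqP; congr (_ * _).
  apply: eq_bigr => k _; rewrite -cats1 takel_cat // sw.
  by rewrite -ltnS.
by rewrite path_meanZ ler_wpM2l.
Qed.

Lemma finite_to_one_map i : finite_to_one (f i).
Proof.
move=> y; have [s [_ _ ->]] := fiber_seq (rf i) (df i) y.
exact: finite_seq.
Qed.

Lemma finite_to_one_word w : finite_to_one (word_map f w).
Proof.
elim/last_ind: w => [y|w i ih y].
  have -> : word_map f [::] @^-1` [set y] = [set y] by [].
  exact: finite_set1.
rewrite word_map_rcons.
have -> : (f i \o word_map f w) @^-1` [set y] =
    \bigcup_(u in f i @^-1` [set y]) word_map f w @^-1` [set u].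
  by apply/seteqP; split => [x /= hx|x [u /= hu ->]//]; exists (word_map f w x).
by apply: bigcup_finite => //; exact: finite_to_one_map.
Qed.

(** The induction removes the first letter, so the fiber of a word is split over
    the points reached after that letter. *)
Lemma transfer_iterE n phi y :
  iter n transfer phi y = ((total_degree f)%:R ^+ n)^-1 *
    \sum_(w : n.-tuple 'I_N) \sum_(z \in word_map f w @^-1` [set y]) phi z.
Proof.
elim: n phi y => [|n ih] phi y.
  rewrite expr0 invr1 mul1r (big_pred1 [tuple]) => [|t]; last first.
    by apply/esym/eqP; exact: tuple0.
  have -> : word_map f [tuple] @^-1` [set y] = [set y] by [].
  by rewrite fsbig_set1.
rewrite iterSr ih exprSr invfM -mulrA; congr (_ * _).
rewrite (reindex (fun p : 'I_N * n.-tuple 'I_N => cons_tuple p.1 p.2)) /=;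
  last first.
  exists (fun t : n.+1.-tuple 'I_N => (thead t, behead_tuple t)).
    by move=> [i t] _ /=; congr (_, _); apply: val_inj.
  by move=> t _; rewrite [RHS]tuple_eta.
rewrite -(pair_bigA _ (fun i (w : n.-tuple 'I_N) =>
   \sum_(z \in word_map f (i :: w) @^-1` [set y]) phi z)) /=.
rewrite exchange_big mulr_sumr; apply: eq_bigr => w _ /=.
rewrite (eq_bigr (fun i : 'I_N => \sum_(u \in word_map f w @^-1` [set y])
   \sum_(z \in f i @^-1` [set u]) phi z)); last first.
  move=> i _; rewrite -cat1s word_map_cat.
  apply: fiber_sum_comp; first exact: finite_to_one_map.
  exact: finite_to_one_word.
have [s us ->] := finite_uniq_seq (finite_to_one_word w y).
rewrite -fsbig_seq //; under [in RHS]eq_bigr do rewrite -fsbig_seq //.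
by rewrite exchange_big mulr_sumr.
Qed.

End Transfer.

(** * Paths that avoid a set at prescribed times *)

Lemma uncountable_reals (R : realType) : ~ countable [set: R].
Proof.
move=> /countable_lebesgue_measure0; rewrite -set_itvNyy lebesgue_measure_itv.
by [].
Qed.

(** How bounds on long time averages pass to the limit. *)
Lemma sum_lin_bound (R : realType) (b C x : R) :
  (forall K : nat, K%:R * x <= K%:R * b + C) -> x <= b.
Proof.
move=> h; rewrite leNgt; apply/negP => bx.
have xb : 0 < x - b by rewrite subr_gt0.
have C0 : 0 <= C by have := h 0%N; rewrite !mul0r add0r.
have := h (Num.bound (C / (x - b))).
have := archi_boundP (divr_ge0 C0 (ltW xb)); set K := Num.bound _ => hK.
rewrite ltr_pdivrMr // in hK.
by rewrite -lerBlDl -mulrBr leNgt hK.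
Qed.

Section Weighted.
Variables (R : realType) (N : nat) (f : 'I_N -> sphere R -> sphere R).
Variable V : set (sphere R).

(** The factors whose product along a path is the indicator of the paths that
    start in [V] and avoid [V] at the times [l, 2l, ..., M l]. *)
Definition window (l M : nat) (k : nat) : sphere R -> R :=
  if k == 0%N then \1_V else
  if ((l %| k) && (k <= l * M))%N then \1_(~` V) else cst 1.

Lemma window_ge0 l M k x : 0 <= window l M k x.
Proof.
rewrite /window; case: ifP => _; first by rewrite indicE ler0n.
by case: ifP => _; [rewrite indicE ler0n|exact: ler01].
Qed.

Lemma weighted_iter (q : nat -> sphere R -> R) n s :
  (forall k, (n < k <= n + s)%N -> q k = cst 1) ->
  weighted f q (n + s) = iter s (transfer f) (weighted f q n).
Proof.
elim: s => [|s ih] qk; first by rewrite addn0.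
rewrite addnS iterS -ih; last first.
  by move=> k /andP[k1 k2]; apply: qk; rewrite k1 addnS ltnW.
apply/funext => y; rewrite /= qk ?mul1r //.
by rewrite addnS ltnS leq_addr leqnn.
Qed.

(** Between two multiples of [l] all factors are 1, so the weights
    accumulate powers of the transfer operator. *)
Lemma weighted_window l M T : (0 < l)%N -> (l * M <= T)%N ->
  weighted f (window l M) T =
  iter (T - l * M) (transfer f) (avoiding (transfer f) \1_V \1_(~` V) l M).
Proof.
move=> l0 lMT; rewrite -{1}(subnKC lMT) weighted_iter; last first.
  move=> k /andP[k1 _]; rewrite /window gtn_eqF ?(leq_trans _ k1) //.
  by rewrite leqNgt k1 andbF.
congr (iter _ _ _).
suff key m : (m <= M)%N -> weighted f (window l M) (l * m) =
    avoiding (transfer f) \1_V \1_(~` V) l m by exact: key.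
elim: m => [|m ih] mM; first by rewrite muln0.
have := ih (ltnW mM) => {}ih.
case: l l0 ih {lMT} => // l' _ ih.
have between : forall k, (l'.+1 * m < k <= l'.+1 * m + l')%N ->
    window l'.+1 M k = cst 1.
  move=> k /andP[k1 k2]; rewrite /window gtn_eqF ?(leq_trans _ k1) //.
  suff /negbTE -> : ~~ (l'.+1 %| k)%N by [].
  apply/negP => /dvdnP[d kd]; move: k1 k2; rewrite kd mulnC.
  rewrite ltn_pmul2r // => md; rewrite leqNgt => /negP; apply.
  by rewrite -addnS -mulSnr leq_mul2r md orbT.
have e : (l'.+1 * m.+1 = (l'.+1 * m + l').+1)%N by rewrite mulnSr addnS.
rewrite e; apply/funext => y; rewrite /= weighted_iter //.
rewrite ih; transitivity (\1_(~` V) y *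
  iter l'.+1 (transfer f)
    (avoiding (transfer f) \1_V \1_(~` V) l'.+1 m) y) => //.
by rewrite iterS /window /= -e dvdn_mulr // leq_pmul2l ?mM.
Qed.

End Weighted.

Definition misses (R : realType) (N : nat) (f : 'I_N -> sphere R -> sphere R)
    (V : set (sphere R)) (l M : nat) (w : word N) (x : sphere R) : Prop :=
  forall k, (0 < k <= M)%N -> ~ V (word_map f (take (k * l) w) x).

Section Bad.
Variables (R : realType) (N : nat) (f : 'I_N -> sphere R -> sphere R).
Hypothesis rf : forall i, rational_map (f i).
Hypothesis df : forall i, (0 < degree (f i))%N.
Variable V : set (sphere R).
Variables (l M : nat -> nat) (J T : nat).
Hypothesis l0 : forall j, (0 < l j)%N.
Hypothesis lMT : forall j, (j < J)%N -> (l j * M j <= T)%N.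
Variable phi : sphere R -> R.
Hypothesis phi1 : forall x, phi x <= 1.
Hypothesis phiV : forall x, 0 < phi x -> V x.
Hypothesis phi_bad : forall x, 0 < phi x -> forall w : word N, size w = T ->
  exists2 j, (j < J)%N & misses f V (l j) (M j) w x.

Let P := transfer f.
Let mP : sub_markov P := transfer_sub_markov rf df.

(** The union bound over the windows: from a point with [phi > 0], every path
    misses at least one of them. *)
Lemma transfer_bad_le y : iter T P phi y <=
  \sum_(j < J) iter (T - l j * M j) P
    (avoiding P \1_V \1_(~` V) (l j) (M j)) y.
Proof.
rewrite -path_mean_transfer.
apply: (@le_trans _ _ (path_mean f T (fun w z => \sum_(j < J)
    \prod_(k < T.+1) window V (l j) (M j) k (word_map f (take k w) z)) y)).
  apply: path_mean_le => // w z sw _.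
  have prod0 (j : nat) : 0 <= \prod_(k < T.+1)
      window V (l j) (M j) k (word_map f (take k w) z).
    by apply: prodr_ge0 => k _; exact: window_ge0.
  have [phi0|phi0] := leP (phi z) 0.
    by apply: le_trans phi0 _; apply: sumr_ge0.
  have [j jJ miss] := phi_bad phi0 sw.
  rewrite (bigD1 (Ordinal jJ)) //=.
  apply: (@le_trans _ _ 1) => //.
  rewrite -[leLHS]addr0 lerD ?sumr_ge0 // big1 // => k _.
  rewrite /window; case: eqP => [->|/eqP k0].
    by rewrite take0 indicE mem_set //; exact: phiV.
  case: ifP => // /andP[/dvdnP[d kd]]; rewrite kd mulnC leq_pmul2l // => dM.
  rewrite indicE mem_set //= [(l j * d)%N]mulnC; apply: miss.
  by rewrite dM andbT; case: (d) kd => // kd; rewrite kd in k0.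
rewrite path_mean_sum //; apply: ler_sum => j _.
rewrite -weighted_window //; last exact: lMT.
by apply: path_mean_prod => // k x; exact: window_ge0.
Qed.

Lemma transfer_bad_mean_le s K y :
  \sum_(n < K) iter (s + n + T) P phi y <=
  \sum_(j < J) (K + l j * M j)%:R / (M j).+1%:R.
Proof.
apply: (@le_trans _ _ (\sum_(n < K) \sum_(j < J)
    iter (s + (T - l j * M j) + n) P
      (avoiding P \1_V \1_(~` V) (l j) (M j)) y)).
  apply: ler_sum => n _; rewrite iterD.
  have mn := sub_markov_iter mP (s + n).
  have [_ _ Lle _] := mn.
  apply: le_trans (Lle _ _ transfer_bad_le y) _.
  rewrite (sub_markov_sum mn (index_enum 'I_J) (fun j : 'I_J =>
    iter (T - l j * M j) P (avoiding P \1_V \1_(~` V) (l j) (M j)))).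
  by apply: ler_sum => j _; rewrite -iterD addnAC.
rewrite exchange_big; apply: ler_sum => j _ /=.
rewrite ler_pdivlMr ?ltr0n // mulrC.
apply: (avoiding_mean_le mP) => x; rewrite ?indicE ?ler0n //.
by rewrite in_setC; case: (x \in V); rewrite /= ?addr0 ?add0r.
Qed.

End Bad.

Section Boyd.
Variables (R : realType) (N : nat) (f : 'I_N -> sphere R -> sphere R).
Hypothesis rf : forall w : word N, w != [::] -> rational_map (word_map f w).
Hypothesis df : forall w : word N, w != [::] -> (0 < degree (word_map f w))%N.

(** Only countably many points are critical values of some word, and the real
    line is uncountable. *)
Lemma generic_point (E : set (sphere R)) (b c : sphere R) : E `<=` [set b; c] ->
  exists2 a, ~ E a & forall w : word N, w != [::] -> forall z,
    word_map f w z = a -> (multiplicity (word_map f w) a z <= 1)%N.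
Proof.
move=> Ebc.
have /choice[bad badP] (w : word N) : exists B : set (sphere R),
    w != [::] -> finite_set B /\ forall a, ~ B a -> forall z,
    word_map f w z = a -> (multiplicity (word_map f w) a z <= 1)%N.
  have [->|w0] := eqVneq w [::]; first by exists set0.
  have [B fB BP] := finite_critical_values (rf w0) (df w0).
  by exists B.
(* The empty word is the index of the exceptional points. *)
pose D := \bigcup_w (if w == [::] then [set b; c] else bad w).
have cD : countable D.
  apply: bigcup_countable => [|w _]; first exact: countableP.
  apply: finite_set_countable; case: eqVneq => [_|/badP[]//].
  by rewrite finite_setU; split; exact: finite_set1.
have [r rD] : exists r : R, ~ D (Some r%:C).
  apply: contrapT => /forallNP all.
  apply: (@uncountable_reals R).
  move/countable_injP: cD => [h hinj]; apply/countable_injP.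
  exists (fun r => h (Some r%:C)) => r s _ _ hrs.
  have e : Some r%:C = Some s%:C :> sphere R.
    by apply: hinj hrs; rewrite inE; exact: contrapT.
  pose re (x : sphere R) := if x is Some (Complex t _) then t else 0.
  exact: (congr1 re e).
exists (Some r%:C); first by move=> /Ebc ?; apply: rD; exists [::].
move=> w w0; apply: (badP w w0).2 => rw; apply: rD; exists w => //.
by rewrite (negbTE w0).
Qed.

Lemma preimage_average_le (a : sphere R) (phi : sphere R -> R) n :
  (forall x, 0 <= phi x) -> (0 < n)%N ->
  (forall w : word N, w != [::] -> forall z,
    word_map f w z = a -> (multiplicity (word_map f w) a z <= 1)%N) ->
  preimage_average f a phi n <= iter n (transfer f) phi a.
Proof.
move=> phi0 n0 simple.
have rf1 i : rational_map (f i) by have := @rf [:: i] isT.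
have df1 i : (0 < degree (f i))%N by have := @df [:: i] isT.
rewrite transfer_iterE // /preimage_average ler_wpM2l ?invr_ge0 ?exprn_ge0 //.
apply: ler_sum => w _.
have w0 : tval w != [::] by rewrite -size_eq0 size_tuple -lt0n.
have [s us sE] := finite_uniq_seq (finite_to_one_word rf1 df1 w a).
rewrite sE -!fsbig_seq // big_seq [leRHS]big_seq; apply: ler_sum => z zs.
rewrite ler_piMl // lern1; apply: simple => //.
by have : [set` s] z by []; rewrite -sE.
Qed.

End Boyd.

(** * Borel measures on the sphere *)

Section MeasureLimit.
Variables (d : measure_display) (T : measurableType d) (R : realType).
Variable mu : probability T R.

Lemma bigcup_setD_small (H : nat -> set T) (e : R) : 0 < e ->
  (forall k, measurable (H k)) -> {homo H : m n / (m <= n)%N >-> m `<=` n} ->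
  exists k, (mu ((\bigcup_n H n) `\` H k) <= e%:E)%E.
Proof.
move=> e0 mH ndH; apply: contrapT => /forallNP no.
have mU : measurable (\bigcup_n H n) by exact: bigcup_measurable.
have mD k : measurable ((\bigcup_n H n) `\` H k) by exact: measurableD.
have D0 : \bigcap_k ((\bigcup_n H n) `\` H k) = set0.
  by rewrite -subset0 => x Hx; have [[n _ Hn] _] := Hx 0%N I;
    have [_] := Hx n I.
have cv : (mu ((\bigcup_n H n) `\` H k) @[k --> \oo] --> 0)%E.
  rewrite -(measure0 mu) -D0; apply: nonincreasing_cvg_mu => //.
  - exact: (le_lt_trans (probability_le1 mu (mD 0%N)) (ltry _)).
  - by rewrite D0.
  - move=> m n mn; apply/subsetPset; apply: setDS; exact: ndH.
have : (e%:E <= lim (mu ((\bigcup_n H n) `\` H k) @[k --> \oo]))%E.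
  apply: lime_ge; first by apply/cvg_ex; exists 0%E.
  by apply: nearW => k; rewrite leNgt; apply/negP => /ltW; exact: no.
by rewrite (cvg_lim _ cv) // lee_fin leNgt e0.
Qed.

Lemma bigcup_measure_le (H : nat -> set T) (b : \bar R) :
  (forall k, measurable (H k)) -> {homo H : m n / (m <= n)%N >-> m `<=` n} ->
  (forall k, (mu (H k) <= b)%E) -> (mu (\bigcup_n H n) <= b)%E.
Proof.
move=> mH ndH Hb.
have cv : mu (H k) @[k --> \oo] --> mu (\bigcup_n H n).
  apply: nondecreasing_cvg_mu => //; first exact: bigcup_measurable.
  by move=> m n mn; apply/subsetPset; exact: ndH.
rewrite -(cvg_lim _ cv) //; apply: lime_le; last exact: nearW.
by apply/cvg_ex; exists (mu (\bigcup_n H n)).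
Qed.

End MeasureLimit.

Section SphereMeasure.
Variable R : realType.
Implicit Types O K : set (sphere R).

Lemma open_borel O : open O -> measurable (O : set (borel_sphere R)).
Proof. by move=> oO; exact: sub_sigma_algebra. Qed.

Lemma closed_borel K : closed K -> measurable (K : set (borel_sphere R)).
Proof.
move=> cK; rewrite -(setCK K); apply: measurableC; apply: open_borel.
exact: closed_openC.
Qed.

Lemma continuous_borel (phi : sphere R -> R) : continuous phi ->
  measurable_fun setT (phi : borel_sphere R -> R).
Proof.
move=> /continuousP cphi; apply: (measurability _ (RGenOpens.measurableE R)).
move=> _ [_ [a [b ->] <-]]; rewrite setTI; apply: open_borel.
exact/cphi/interval_open.
Qed.

Variable mu : probability (borel_sphere R) R.

Lemma closed_le_integral K (phi : sphere R -> R) : closed K ->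
  continuous phi -> (forall x, 0 <= phi x <= 1) ->
  (forall x, K x -> phi x = 1) ->
  (mu K <= (\int[mu]_x phi x)%:E)%E.
Proof.
move=> cK cphi phi01 phiK.
have mK := closed_borel cK; have mphi := continuous_borel cphi.
have mphiE := (measurable_EFinP _ _).2 mphi.
have phi0 x : (0 <= (phi x)%:E)%E by rewrite lee_fin; case/andP: (phi01 x).
rewrite /Rintegral fineK; last first.
  rewrite ge0_fin_numE; last exact: integral_ge0.
  apply: (@le_lt_trans _ _ (\int[mu]_x (cst 1 x))%E).
    apply: ge0_le_integral => //.
    by move=> x _; rewrite lee_fin; case/andP: (phi01 x).
  by rewrite integral_cst // mul1e (le_lt_trans (probability_le1 mu _)) // ltry.
have <- : (\int[mu]_x (\1_(K : set (borel_sphere R)) x)%:E = mu K)%E.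
  by have := integral_indic mu measurableT mK; rewrite setIT.
apply: ge0_le_integral => //.
- by apply/measurable_EFinP; exact: measurable_indic.
- move=> x _; rewrite lee_fin indicE; have [xK|_] := boolP (x \in _).
    by rewrite phiK //; move: xK; rewrite inE.
  by case/andP: (phi01 x).
Qed.

(** The sets [k psi >= 1], with [psi] positive exactly on [O]. *)
Lemma open_exhaustion O : open O -> exists F : nat -> set (sphere R),
  [/\ forall k, closed (F k), {homo F : m n / (m <= n)%N >-> m `<=` n},
      \bigcup_k F k = O &
      forall k, exists2 phi : sphere R -> R, continuous phi &
        [/\ forall x, 0 <= phi x <= 1, forall x, F k x -> phi x = 1
          & forall x, 0 < phi x -> O x] ].
Proof.
move=> oO; have [psi [cpsi psi0 psiO]] := sphere_cozero oO.
exists (fun k => [set x | 1 <= k%:R * psi x]).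
have ck k : continuous (fun x => k%:R * psi x).
  by move=> x; exact: (cvgM (cvg_cst (k%:R : R)) (cpsi x)).
split.
- move=> k.
  apply: (@preimage_closed _ _ (fun x => k%:R * psi x) [set y | 1 <= y]).
    by move=> x _; exact: ck.
  exact: closed_ge.
- by move=> m n mn x /= h; rewrite (le_trans h) // ler_wpM2r // ler_nat.
- apply/seteqP; split => [x [k _ /=]|x /psiO p0].
    move=> h; apply/psiO; rewrite lt_neqAle psi0 andbT eq_sym.
    by apply: contraTN h => /eqP ->; rewrite mulr0 ler10.
  have := archi_boundP (ltW (_ : 0 < (psi x)^-1)).
  rewrite invr_gt0 => /(_ p0) h.
  exists (Num.bound (psi x)^-1) => //=.
  by rewrite -ler_pdivrMr // div1r ltW.
- move=> k; exists (fun x => Num.min 1 (k%:R * psi x)).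
    move=> x; exact: (@continuous_min R (sphere R) (cst 1)
      (fun x => k%:R * psi x) x (@cst_continuous _ _ _ x) (ck k x)).
  split => x.
  + by rewrite le_min ler01 mulr_ge0 //= ge_min lexx.
  + by move=> /= h; apply/min_idPl.
  + rewrite lt_min ltr01 /= => h; apply/psiO.
    rewrite lt_neqAle psi0 andbT eq_sym.
    by apply: contraTN h => /eqP ->; rewrite mulr0 ltxx.
Qed.

Lemma open_measure_le O (b : R) : open O ->
  (forall phi : sphere R -> R, continuous phi -> (forall x, 0 <= phi x <= 1) ->
    (forall x, 0 < phi x -> O x) -> \int[mu]_x phi x <= b) ->
  (mu O <= b%:E)%E.
Proof.
move=> oO ib; have [F [cF ndF FO phiF]] := open_exhaustion oO.
rewrite -[X in mu X]FO.
apply: bigcup_measure_le => // k; first exact: closed_borel.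
have [phi cphi [phi01 phi1 phiO]] := phiF k.
apply: le_trans (closed_le_integral (cF k) cphi phi01 phi1) _.
by rewrite lee_fin; exact: ib.
Qed.

(** Approximation from both sides; unlike inner approximation alone, this is
    stable under complements. *)
Let regular (A : set (borel_sphere R)) := forall e : R, 0 < e ->
  exists F G : set (sphere R),
    [/\ closed F, open G, F `<=` A, A `<=` G & (mu (G `\` F) <= e%:E)%E].

(** The sets that can be approximated form a sigma-algebra containing the open
    sets. *)
Lemma closed_inner_regular (B : set (borel_sphere R)) (e : R) :
  measurable B -> 0 < e ->
  exists K : set (sphere R), [/\ closed K, K `<=` B & (mu (B `\` K) <= e%:E)%E].
Proof.
suff reg : @measurable _ (borel_sphere R) `<=` regular.
  move=> mB e0; have [F [G [cF oG FB BG h]]] := reg _ mB e e0.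
  exists F; split => //; apply: le_trans h; apply: le_measure; rewrite ?inE.
  - by apply: measurableD => //; exact: closed_borel.
  - by apply: measurableD; [exact: open_borel|exact: closed_borel].
  - exact: setSD.
clear B e; apply: smallest_sub; last first.
  move=> O oO e e0; have [F [cF ndF FO _]] := open_exhaustion oO.
  have [|k hk] := bigcup_setD_small mu e0 _ ndF.
    by move=> k; exact: closed_borel.
  exists (F k), O; split => //; last by rewrite -FO.
  by rewrite -FO; exact: bigcup_sup.
split.
- move=> e e0; exists set0, set0.
  split; [exact: closed0|exact: open0|by []|by []|].
  by rewrite setD0 measure0 lee_fin ltW.
- move=> A rA e e0; have [F [G [cF oG FA AG h]]] := rA e e0.
  exists (~` G), (~` F); split; rewrite ?setTD.
  + exact: open_closedC.
  + exact: closed_openC.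
  + exact: subsetC.
  + exact: subsetC.
  + by rewrite setDE setCK setIC -setDE.
- move=> A rA e e0.
  have e2 : 0 < e / 2 by rewrite divr_gt0.
  have /choice[FG FGP] (n : nat) : exists FG : set (sphere R) * set (sphere R),
      [/\ closed FG.1, open FG.2, FG.1 `<=` A n, A n `<=` FG.2
        & (mu (FG.2 `\` FG.1) <= (e / 2 / (2 ^ n.+1)%:R)%:E)%E].
    have en : 0 < e / 2 / (2 ^ n.+1)%:R by rewrite divr_gt0 ?ltr0n ?expn_gt0.
    by have [F [G ?]] := rA n _ en; exists (F, G).
  pose H k := \bigcup_(n in [set n | (n < k)%N]) (FG n).1.
  pose G := \bigcup_n (FG n).2.
  have cH k : closed (H k).
    apply: closed_bigcup; first exact: finite_II.
    by move=> n _; have [] := FGP n.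
  have ndH : {homo H : m n / (m <= n)%N >-> m `<=` n}.
    by move=> m n mn x [i /= im Fi]; exists i => //=; exact: leq_trans mn.
  have oG : open G by apply: bigcup_open => n _; have [] := FGP n.
  have [|k hk] := bigcup_setD_small mu e2 _ ndH.
    by move=> k; exact: closed_borel.
  have mF n : measurable ((FG n).1 : set (borel_sphere R)).
    by apply: closed_borel; have [] := FGP n.
  have mG n : measurable ((FG n).2 : set (borel_sphere R)).
    by apply: open_borel; have [] := FGP n.
  exists (H k), G; split => //.
  + by move=> x [n _ Fn]; exists n => //; have [_ _ + _ _] := FGP n; apply.
  + by move=> x [n _ An]; exists n => //; have [_ _ _ + _] := FGP n; apply.
  have mHk n : measurable (H n : set (borel_sphere R)) by exact: closed_borel.
  have mHU : measurable (\bigcup_n H n : set (borel_sphere R)).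
    exact: bigcup_measurable.
  have mGo : measurable (G : set (borel_sphere R)) by exact: open_borel.
  apply: (@le_trans _ _ (mu ((G `\` \bigcup_n H n) `|`
      ((\bigcup_n H n) `\` H k)))%E).
    apply: le_measure; rewrite ?inE; [exact: measurableD| |].
      by apply: measurableU; exact: measurableD.
    move=> x [Gx Hx]; have [Ux|Ux] := pselect ((\bigcup_n H n) x).
      by right.
    by left.
  apply: le_trans (measureU2 _ _ _) _; [exact: measurableD|exact: measurableD|].
  rewrite (splitr e) EFinD; apply: leeD => //.
  apply: le_trans (epsilon_trick0 xpredT (ltW e2)).
  apply: (@le_trans _ _ (\sum_(0 <= n <oo) mu ((FG n).2 `\` (FG n).1))%E).
    apply: measure_sigma_subadditive; [by move=> n; exact: measurableD| |].
      exact: measurableD.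
    move=> x [[n _ Gn] Hx]; exists n => //; split => // Fn; apply: Hx.
    by exists n.+1 => //; exists n => //=.
  by apply: lee_nneseries => // n _; have [] := FGP n.
Qed.

End SphereMeasure.

(** * Boyd measures and missed windows *)

Section Windows.
Variables (R : realType) (N : nat) (f : 'I_N -> sphere R -> sphere R).
Hypothesis rf : forall w : word N, w != [::] -> rational_map (word_map f w).
Hypothesis df : forall w : word N, w != [::] -> (0 < degree (word_map f w))%N.
Variable mu : probability (borel_sphere R) R.
Hypothesis boyd_mu : boyd_measure f mu.

Let rf1 i : rational_map (f i). Proof. by have := @rf [:: i] isT. Qed.
Let df1 i : (0 < degree (f i))%N. Proof. by have := @df [:: i] isT. Qed.

Definition always_misses (V : set (sphere R)) (l M : nat -> nat) (J T : nat)
    (x : sphere R) : Prop :=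
  forall w : word N, size w = T ->
    exists2 j, (j < J)%N & misses f V (l j) (M j) w x.

(** Sum [preimage_average_le] over a long range of [n] and bound the right side
    by [transfer_bad_mean_le]; the error terms do not grow with the range. *)
Lemma boyd_integral_le (V : set (sphere R)) (l M : nat -> nat) (J T : nat)
    (phi : sphere R -> R) :
  (forall j, (0 < l j)%N) -> (forall j, (j < J)%N -> (l j * M j <= T)%N) ->
  continuous phi -> (forall x, 0 <= phi x <= 1) ->
  (forall x, 0 < phi x -> V x /\ always_misses V l M J T x) ->
  \int[mu]_x phi x <= \sum_(j < J) (M j).+1%:R^-1.
Proof.
move=> l0 lMT cphi phi01 phibad.
have [E [[b [c Ebc]] cvgE]] := boyd_mu.
have [a Ea simple] := generic_point rf df Ebc.
have cva := cvgE a Ea phi cphi.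
apply/ler_addgt0Pr => e e0; rewrite -lerBlDr.
apply: (@sum_lin_bound _ _ (\sum_(j < J) (l j * M j)%:R / (M j).+1%:R)) => K.
have /cvgrPdist_lt/(_ e e0)[n0 _ hn0] := cva.
(* The range starts at [n0 + 1], as [a] is generic for nonempty words. *)
apply: le_trans (_ : _ <=
  \sum_(n < K) iter (n0.+1 + n + T) (transfer f) phi a) _.
  rewrite mulr_natl -[K in _ *+ K]card_ord -sumr_const; apply: ler_sum => n _.
  have : (n0 <= n0.+1 + n + T)%N by rewrite -addnA addSn leqW // leq_addr.
  move=> /hn0 /=; rewrite ltr_distlC => /andP[lo _].
  rewrite ltW // (lt_le_trans lo) //; apply: preimage_average_le => //.
  by move=> x; case/andP: (phi01 x).
apply: le_trans (@transfer_bad_mean_le _ _ _ rf1 df1 V l M J T l0 lMT phi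
  _ _ _ n0.+1 K a) _.
- by move=> x; case/andP: (phi01 x).
- by move=> x /phibad[].
- by move=> x /phibad[_ h]; exact: h.
rewrite mulr_sumr -big_split /=; apply: ler_sum => j _.
by rewrite natrD mulrDl.
Qed.

Lemma continuous_word w : continuous (word_map f w).
Proof.
have [->|w0] := eqVneq w [::]; first by move=> x; exact: cvg_id.
exact/continuous_rational_map/rf.
Qed.

Lemma open_always_misses V l M J T : closed V -> open (always_misses V l M J T).
Proof.
move=> cV; rewrite openE => x xbad; rewrite /interior.
have one (w : T.-tuple 'I_N) : nbhs x [set y |
    exists2 j, (j < J)%N & misses f V (l j) (M j) w y].
  have [j jJ miss] := xbad w (size_tuple w).
  suff : nbhs x (misses f V (l j) (M j) w).
    by apply: filterS => y hy; exists j.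
  have h (k : 'I_(M j).+1) : nbhs x
      [set y | (0 < k)%N -> ~ V (word_map f (take (k * l j) w) y)].
    have [kz|k0] := posnP k; first by apply: filterE => y /=; rewrite kz.
    have : nbhs x (word_map f (take (k * l j) w) @^-1` (~` V)).
      apply: continuous_word; apply: open_nbhs_nbhs; split.
        exact: closed_openC.
      by apply: miss; rewrite k0 -ltnS ltn_ord.
    by apply: filterS => y hy _; exact: hy.
  have := filter_forall (nbhs_filter x) h.
  apply: filterS => y hy k /andP[k0 kM].
  exact: (hy (Ordinal (kM : (k < (M j).+1)%N))).
have := filter_forall (nbhs_filter x) one.
by apply: filterS => y hy w /eqP sw; exact: (hy (Tuple sw)).
Qed.

End Windows.

Section Scale.
Variable M : nat -> nat.
Hypothesis M0 : forall j, (0 < M j)%N.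

(** With these scales, the window [{l_j, 2 l_j, ..., M_j l_j}] ends before
    [l_(j+1)]. *)
Fixpoint scale (j : nat) : nat := if j is i.+1 then (scale i * M i).+1 else 1.

Lemma scale_gt0 j : (0 < scale j)%N.
Proof. by case: j. Qed.

Lemma scale_le i j : (i <= j)%N -> (scale i <= scale j)%N.
Proof.
apply: (homo_leq (leqnn) leq_trans) => k /=.
by rewrite ltnW // ltnS leq_pmulr.
Qed.

Lemma scale_window i j : (i < j)%N -> (scale i * M i < scale j)%N.
Proof. by move=> /scale_le; apply: leq_trans; rewrite /= leqnn. Qed.

End Scale.

(** [M_j = c 2^(j+1)] with [c > 1/e]. *)
Lemma fast_sequence (R : realType) (e : R) : 0 < e ->
  exists2 M : nat -> nat, forall j, (0 < M j)%N &
    forall J, \sum_(j < J) (M j).+1%:R^-1 <= e.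
Proof.
move=> e0; pose c := (Num.bound e^-1).+1.
have ce : e^-1 < c%:R.
  apply: lt_trans (archi_boundP _) _; first by rewrite invr_ge0 ltW.
  by rewrite ltr_nat.
exists (fun j => c * 2 ^ j.+1)%N => [j|J].
  by rewrite muln_gt0 /= expn_gt0.
have pow2 n : 0 < (2 ^ n)%:R :> R by rewrite ltr0n expn_gt0.
apply: (@le_trans _ _ (e - e / (2 ^ J)%:R)); last first.
  by rewrite gerBl divr_ge0 // ltW.
elim: J => [|J ih]; first by rewrite big_ord0 expn0 divr1 subrr.
rewrite big_ord_recr /=; apply: le_trans (lerD ih _ : _ <=
  _ + e / (2 ^ J.+1)%:R) _.
  apply: (@le_trans _ _ (c * 2 ^ J.+1)%:R^-1).
    rewrite lef_pV2 ?posrE ?ltr0n ?muln_gt0 ?expn_gt0 //.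
    by rewrite ler_nat.
  rewrite natrM invfM ler_wpM2r ?invr_ge0 //.
  by rewrite invf_ple ?posrE ?ltr0n // ltW.
have := pow2 J; rewrite expnS natrM => p.
suff -> : e / (2 ^ J)%:R = e / (2 * (2 ^ J)%:R) + e / (2 * (2 ^ J)%:R).
  by rewrite opprD addrA subrK.
by field; rewrite gt_eqF.
Qed.

Section AlwaysMisses.
Variables (R : realType) (N : nat) (f : 'I_N -> sphere R -> sphere R).

Lemma sub_always_misses (V W : set (sphere R)) l M J T :
  V `<=` W -> always_misses f W l M J T `<=` always_misses f V l M J T.
Proof.
move=> VW x Wx w sw; have [j jJ miss] := Wx w sw.
by exists j => // k hk Vk; apply: (miss k hk); exact: VW.
Qed.

Lemma always_misses_longer (V : set (sphere R)) M J K :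
  (forall j, (0 < M j)%N) -> (J <= K)%N ->
  always_misses f V (scale M) M J (scale M J) `<=`
  always_misses f V (scale M) M K (scale M K).
Proof.
move=> M0 JK x Jx w sw; have JKs := scale_le M0 JK.
have [|j jJ miss] := Jx (take (scale M J) w).
  by rewrite size_takel // sw.
exists j => [|k hk]; first exact: leq_trans JK.
have := miss k hk; rewrite take_takel //.
have [k0 kM] := andP hk.
apply: leq_trans (ltnW (scale_window M0 jJ)).
by rewrite mulnC leq_mul2l kM orbT.
Qed.

End AlwaysMisses.

Section Closed.
Variables (R : realType) (N : nat) (f : 'I_N -> sphere R -> sphere R).
Hypothesis rf : forall w : word N, w != [::] -> rational_map (word_map f w).
Hypothesis df : forall w : word N, w != [::] -> (0 < degree (word_map f w))%N.
Variable mu : probability (borel_sphere R) R.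
Hypothesis boyd_mu : boyd_measure f mu.

(** With [psi] positive exactly off [K], let [V_i] be the closed neighbourhood
    [psi <= 1/(i+1)] of [K].  The points of [K] all of whose words miss [V_i]
    during one of the first [i] windows lie in the open set of the points with
    the same property where [psi < 1/(i+1)], so they have measure at most [e],
    and they increase with [i].  If all words of a point miss [K] during one
    of the first [J] windows, then finitely many positions avoid [K], hence also
    [V_i] for large [i]. *)
Lemma closed_always_misses (K : set (sphere R)) (M : nat -> nat) (e : R) :
  closed K -> (forall j, (0 < M j)%N) ->
  (forall J, \sum_(j < J) (M j).+1%:R^-1 <= e) ->
  exists A : set (borel_sphere R), [/\ measurable A, (mu A <= e%:E)%E &
    forall x, K x -> ~ A x ->
      forall J, ~ always_misses f K (scale M) M J (scale M J) x].
Proof.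
move=> cK M0 Me.
have [psi [cpsi psi0 psiK]] := sphere_cozero (closed_openC cK).
have psiK0 x : K x -> psi x = 0.
  move=> Kx; apply/eqP; rewrite eq_le psi0 andbT leNgt.
  by apply/negP => /psiK.
pose V (i : nat) : set (sphere R) := [set x | psi x <= i.+1%:R^-1].
have cV i : closed (V i).
  apply: (@preimage_closed _ _ psi [set y | y <= i.+1%:R^-1]).
    by move=> x _; exact: cpsi.
  exact: closed_le.
have KV i : K `<=` V i.
  by move=> x /psiK0; rewrite /V /= => ->; rewrite invr_ge0.
pose bad i := always_misses f (V i) (scale M) M i (scale M i).
have obad i : open (bad i) by exact: open_always_misses.
pose G i : set (borel_sphere R) := K `&` bad i.
have mG i : measurable (G i).
  by apply: measurableI; [exact: closed_borel|exact: open_borel].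
have ndG : {homo G : m n / (m <= n)%N >-> m `<=` n}.
  move=> m n mn x [Kx badx]; split => //.
  apply: (always_misses_longer M0 mn); apply: sub_always_misses badx.
  move=> y /= h; apply: le_trans h _.
  by rewrite lef_pV2 ?posrE ?ltr0n // ler_nat.
exists (\bigcup_i G i); split; first exact: bigcup_measurable.
- apply: bigcup_measure_le => // i.
  pose U : set (sphere R) := psi @^-1` [set y | y < i.+1%:R^-1].
  have oU : open U.
    by have /continuousP := cpsi; apply; exact: open_lt.
  apply: (@le_trans _ _ (mu (U `&` bad i))).
    apply: le_measure; rewrite ?inE //.
      by apply: measurableI; exact: open_borel.
    by move=> x [Kx bx]; split => //; rewrite /U /= psiK0.
  apply: open_measure_le => [|phi cphi phi01 phiU]; first exact: openI.
  apply: le_trans (Me i).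
  apply: (boyd_integral_le rf df boyd_mu (V := V i) (l := scale M)
    (T := scale M i)) => //.
  + exact: scale_gt0.
  + by move=> j /(scale_window M0)/ltnW.
  + by move=> x /phiU[Ux bx]; split => //; exact: ltW.
- move=> x Kx Ax J Jx; apply: Ax.
  pose p (wk : (scale M J).-tuple 'I_N * 'I_(scale M J).+1) :=
    psi (word_map f (take wk.2 wk.1) x).
  have near1 wk : \forall i \near \oo, 0 < p wk -> i.+1%:R^-1 < p wk.
    have [->|pn0] := eqVneq (p wk) 0; first by apply: nearW; rewrite ltxx.
    have p0 : 0 < p wk by rewrite lt_neqAle eq_sym pn0 psi0.
    have := near_infty_natSinv_lt (PosNum p0).
    by apply: filterS => i /= hi _.
  have nearall : \forall i \near \oo, (forall wk, 0 < p wk -> i.+1%:R^-1 < p wk)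
      /\ (J <= i)%N.
    apply: filterI; last exact: nbhs_infty_ge.
    exact: (filter_forall _ near1).
  have [i [pi Ji]] := filter_ex nearall.
  exists i => //; split => //.
  apply: (always_misses_longer M0 Ji) => w /eqP sw.
  have [j jJ miss] := Jx w (eqP sw).
  exists j => // k hk; have /psiK := miss k hk => pk.
  have kJ : (k * scale M j < (scale M J).+1)%N.
    rewrite ltnS (leq_trans _ (ltnW (scale_window M0 jJ))) //.
    by have [_ kM] := andP hk; rewrite mulnC leq_mul2l kM orbT.
  apply/negP; rewrite -ltNge.
  exact: (pi (Tuple sw, Ordinal kJ)).
Qed.

End Closed.

(** * Infinite words and conclusion *)

(** The third hypothesis says that [good J] only depends on the first [L J]
    letters; it makes the prefixes of the infinite word good, and not only
    extendable to good words. *)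
Lemma koenig (T : finType) (good : nat -> seq T -> Prop) (L : nat -> nat) :
  (forall J w u, good J w -> good J (w ++ u)) ->
  (forall J K w, (J <= K)%N -> good K w -> good J w) ->
  (forall J w, good J w -> good J (take (L J) w)) ->
  (forall J, exists2 w, good J w & w != [::]) ->
  exists sigma : nat -> T, forall J, good J (mkseq sigma (L J)).
Proof.
move=> good_cat good_le good_take good_ex.
have [[//|i0 w0] _ _] := good_ex 0%N.
pose extendable w := forall J, exists u, good J (w ++ u).
have step w : exists i, extendable w -> extendable (rcons w i).
  apply: contrapT => /forallNP no.
  have ext_w : extendable w by apply: contrapT => h; apply: (no i0) => /h.
  have /choice[K KP] (i : T) : exists J, forall u, ~ good J (rcons w i ++ u).
    have /not_implyP[_ /existsNP[J /forallNP hJ]] := no i.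
    by exists J.
  (* If no letter can be appended, one level is out of reach for all. *)
  pose J := \max_i K i.
  have KJ i : (K i <= J)%N by exact: leq_bigmax.
  have [[|i u] gu] := ext_w J.
    apply: (KP i0 [::]); apply: (good_le _ J) => //; rewrite cats0 -cats1.
    by apply: good_cat; rewrite cats0 in gu.
  by apply: (KP i u); apply: (good_le _ J) => //; rewrite cat_rcons.
have /choice[next nextP] := step.
pose s := fix s n := if n is m.+1 then rcons (s m) (next (s m)) else [::].
have ext_s n : extendable (s n).
  elim: n => [J|n ih]; last exact: nextP.
  by have [w gw _] := good_ex J; exists w.
have sE n : s n = mkseq (fun m => next (s m)) n.
  by elim: n => [//|n ih]; rewrite mkseqS -ih.
exists (fun m => next (s m)) => J; rewrite -sE.
have [u gu] := ext_s (L J) J.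
have := good_take _ _ gu; rewrite take_size_cat //.
by rewrite sE size_mkseq.
Qed.

Lemma take_mkseq (T : Type) (sigma : nat -> T) m n : (m <= n)%N ->
  take m (mkseq sigma n) = mkseq sigma m.
Proof. by move=> mn; rewrite /mkseq -map_take take_iota (minn_idPl mn). Qed.

Definition recurrent (R : realType) (N : nat) (f : 'I_N -> sphere R -> sphere R)
    (B : set (sphere R)) (x : sphere R) : Prop :=
  exists (n : nat -> nat) (g : nat -> word N),
      [/\ forall i, (0 < n i)%N,
          {homo n : i j / (i < j)%N},
          forall i, size (g i) = n i,
          forall i, exists h : word N,
            size h = (n i.+1 - n i)%N /\ g i.+1 = word_comp h (g i)
        & forall i, B (word_map f (g i) x)].

Lemma sub_recurrent (R : realType) (N : nat) (f : 'I_N -> sphere R -> sphere R)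
    (K B : set (sphere R)) : K `<=` B -> recurrent f K `<=` recurrent f B.
Proof.
move=> KB x [n [g [h1 h2 h3 h4 h5]]]; exists n, g; split => // i.
exact/KB/h5.
Qed.

Lemma recurrent_of_visits (R : realType) (N : nat)
    (f : 'I_N -> sphere R -> sphere R) (K : set (sphere R)) (M : nat -> nat)
    (x : sphere R) : (forall j, (0 < M j)%N) ->
  (forall J, ~ always_misses f K (scale M) M J (scale M J) x) ->
  recurrent f K x.
Proof.
move=> M0 nomiss.
pose visits (j : nat) (w : word N) := exists k, [/\ (0 < k <= M j)%N,
  (k * scale M j <= size w)%N & K (word_map f (take (k * scale M j) w) x)].
pose good J (w : word N) := forall j, (j < J)%N -> visits j w.
have kJ j J k : (j < J)%N -> (0 < k <= M j)%N -> (k * scale M j <= scale M J)%N.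
  move=> jJ /andP[_ kM]; apply: leq_trans (ltnW (scale_window M0 jJ)).
  by rewrite mulnC leq_mul2l kM orbT.
have [] := @koenig 'I_N good (scale M).
- move=> J w u gw j jJ; have [k [hk kw Kk]] := gw j jJ; exists k; split => //.
    by rewrite size_cat (leq_trans kw) // leq_addr.
  by rewrite takel_cat.
- by move=> J J' w JJ' gw j jJ; apply: gw; exact: leq_trans JJ'.
- move=> J w gw j jJ; have [k [hk kw Kk]] := gw j jJ; exists k.
  have kl := kJ _ _ _ jJ hk.
  by split => //; rewrite ?size_take_min ?leq_min ?kl // take_takel.
- move=> J; have /existsNP[w /not_implyP[sw now]] := nomiss J.
  exists w; last by rewrite -size_eq0 sw -lt0n scale_gt0.
  move=> j jJ; apply: contrapT => nov; apply: now; exists j => // k hk Kk.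
  by apply: nov; exists k; rewrite sw kJ.
move=> sigma sigmaP.
have /choice[k kP] (j : nat) : exists k, (0 < k <= M j)%N /\
    K (word_map f (mkseq sigma (k * scale M j)) x).
  have [k [hk kw Kk]] := sigmaP j.+1 j (ltnSn j); exists k; split => //.
  by move: Kk; rewrite take_mkseq // (kJ _ j.+1).
pose n j := (k j * scale M j)%N.
have n_lt : {homo n : i j / (i < j)%N}.
  apply: (homo_ltn ltn_trans) => j.
  have [/andP[k0 kM] _] := kP j; have [/andP[k0' _] _] := kP j.+1.
  apply: (@leq_trans (scale M j.+1)); last by rewrite leq_pmull.
  by rewrite ltnS /n mulnC leq_mul2l kM orbT.
exists n, (fun j => mkseq sigma (n j)); split => //.
- by move=> j; rewrite muln_gt0 scale_gt0 andbT; have [/andP[]] := kP j.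
- by move=> j; rewrite size_mkseq.
- move=> j; exists (drop (n j) (mkseq sigma (n j.+1))).
  rewrite size_drop size_mkseq; split => //.
  rewrite /word_comp -(take_mkseq sigma (ltnW (n_lt _ _ (ltnSn j)))).
  by rewrite cat_take_drop.
- by move=> j; have [] := kP j.
Qed.

Lemma negligible_small (d : measure_display) (T : measurableType d)
    (R : realType) (mu : {measure set T -> \bar R}) (Z : set T) :
  (forall e : R, 0 < e ->
    exists A, [/\ measurable A, (mu A <= e%:E)%E & Z `<=` A]) ->
  mu.-negligible Z.
Proof.
move=> small.
have /choice[A AP] (n : nat) : exists A, [/\ measurable A,
    (mu A <= (n.+1%:R^-1)%:E)%E & Z `<=` A].
  by apply: small; rewrite invr_gt0.
have mA : measurable (\bigcap_n A n).
  by apply: bigcap_measurable => // n _; have [] := AP n.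
exists (\bigcap_n A n); split => //; last first.
  by move=> x Zx n _; have [_ _] := AP n; apply.
apply/eqP; rewrite eq_le measure_ge0 andbT.
apply/lee_addgt0Pr => e e0; rewrite add0e.
have [n _ hn] := near_infty_natSinv_lt (PosNum e0).
have [mAn An _] := AP n.
apply: (@le_trans _ _ (mu (A n))).
  apply: le_measure; rewrite ?inE //.
  by move=> x; apply.
by apply: le_trans An _; rewrite lee_fin ltW // hn /=.
Qed.

Theorem theorem1p6 (R : realType) (S : set (sphere R -> sphere R))
    (N : nat) (f : 'I_N -> sphere R -> sphere R)
    (mu : probability (borel_sphere R) R) (B : set (borel_sphere R))
    (semigroup_S : rational_semigroup S)
    (degree_S : forall g, S g -> (2 <= degree g)%N)
    (generated_S : generated_by S f)
    (boyd_mu : boyd_measure f mu)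
    (measurable_B : measurable B)
    (Julia_B : B `<=` Julia S)
    (mu_B : (0 < mu B)%E) :
  {ae mu, forall x, B x ->
    exists (n : nat -> nat) (g : nat -> word N),
      [/\ forall i, (0 < n i)%N,
          {homo n : i j / (i < j)%N},
          forall i, size (g i) = n i,
          forall i, exists h : word N,
            size h = (n i.+1 - n i)%N /\ g i.+1 = word_comp h (g i)
        & forall i, B (word_map f (g i) x)]}.
Proof.
have [_ S_rational S_comp] := semigroup_S.
have S_word (w : word N) : w != [::] -> S (word_map f w).
  elim/last_ind: w => [//|w i ih] _; rewrite word_map_rcons.
  have Sf : S (f i) by rewrite generated_S; apply: sub_gen_smallest; exists i.
  have [->|/ih Sw] := eqVneq w [::]; first exact: Sf.
  exact: S_comp.
have rf (w : word N) : w != [::] -> rational_map (word_map f w).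
  by move=> /S_word /S_rational[].
have df (w : word N) : w != [::] -> (0 < degree (word_map f w))%N.
  by move=> /S_word /degree_S; exact: leq_trans.
apply: negligible_small => e e0.
have e2 : 0 < e / 2 by rewrite divr_gt0.
have [K [cK KB BK]] := closed_inner_regular mu measurable_B e2.
have [M M0 Me] := fast_sequence e2.
have [A [mA Ae AP]] := closed_always_misses rf df boyd_mu cK M0 Me.
have mBK : measurable (B `\` K).
  by apply: measurableD => //; exact: closed_borel.
exists ((B `\` K) `|` A); split; first exact: measurableU.
  apply: le_trans (measureU2 _ mBK mA) _.
  by rewrite (splitr e) EFinD; exact: leeD.
move=> x; apply: contra_notP => /not_orP[BKx Ax] Bx.
apply: (sub_recurrent KB); apply: (recurrent_of_visits M0); apply: AP => //.
by apply: contrapT => Kx; apply: BKx.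
Qed.
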